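(* Solutions $w$ to the equation $$-w_t(t,a)+f''(t)\,a\,w(t,a)=\frac12 w_{aa}(t,a)$$ are given by $$w(t,a)=e^{\frac12\int_t^s (f'(u))^2du+af'(t)}\;\frac{1}{2\pi}\int_{-\infty}^{\infty}\Pi(y)\,e^{-\frac12 y^2(s-t)+iy\left(a+\int_t^s f'(u)\,du\right)}\,dy$$ $$\phantom{w(t,a)}=e^{\frac12\int_t^s (f'(u))^2du+af'(t)}\;\omega\left(s-t,\;a+\int_t^s f'(u)\,du\right),$$ where $\omega$ is a solution to the heat equation.
   Context: The function $f$ is twice continuously differentiable with $f(t)=f(0)+\int_0^t f'(u)\,du$, $f''(t)>0$ and $\int_0^t (f'(u))^2\,du<\infty$ for all $t>0$. The number $s>0$ is a fixed terminal time, $t\in[0,s)$ is the time variable and $a$ is the space variable; subscripts on $w$ denote partial derivatives, and $i=\sqrt{-1}$. $\Pi$ is a function of $y$ alone (not depending on $t$ or $a$), otherwise unspecified. The heat equation for $\omega=\omega(\tau,x)$ is $\omega_\tau(\tau,x)=\frac12\omega_{xx}(\tau,x)$.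
   Formalization: Not every solution has the first form (ω=1 has no function Π); that every solution has it is claimed only for solutions where e^{-af'(t)}w(t,a) is, for each t, a Fourier integral in a of an L¹ amplitude with norms locally bounded in t. The second form is proved for all classical solutions. *)

(* Defs.v *)
From HB Require Import structures.
From mathcomp Require Import all_boot all_order all_algebra.
From mathcomp Require Import all_classical all_reals all_analysis.
From mathcomp.real_closed Require Import complex.
Set Implicit Arguments.
Unset Strict Implicit.
Unset Printing Implicit Defensive.
Import Order.TTheory GRing.Theory Num.Theory.
Import numFieldNormedType.Exports.
Local Open Scope classical_set_scope.
Local Open Scope ring_scope.
Local Open Scope complex_scope.

(* Functions with values in R[i] are integrated and differentiated through
   their real and imaginary parts. *)

Definition cexp (R : realType) (z : R[i]) : R[i] :=
  (expR (complex.Re z))%:C *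
  (cos (complex.Im z) +i* sin (complex.Im z)).

Definition cintegrable (R : realType) (g : R -> R[i]) : Prop :=
  (@lebesgue_measure R).-integrable setT (fun y => (complex.Re (g y))%:E) /\
  (@lebesgue_measure R).-integrable setT (fun y => (complex.Im (g y))%:E).

Definition cintegral (R : realType) (g : R -> R[i]) : R[i] :=
  (\int[@lebesgue_measure R]_y complex.Re (g y)) +i*
  (\int[@lebesgue_measure R]_y complex.Im (g y)).

(* Derivative at t relative to the set J: the usual derivative when t is
   interior to J, the one-sided derivative when t is an endpoint of J. *)
Definition derive_within (R : realType) (J : set R) (g : R -> R) (t l : R)
    : Prop :=
  (g u - g t) / (u - t) @[u --> within J t^'] --> l.

Definition cderive_within (R : realType) (J : set R) (g : R -> R[i]) (t : R)
    (l : R[i]) : Prop :=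
  derive_within J (fun u => complex.Re (g u)) t (complex.Re l) /\
  derive_within J (fun u => complex.Im (g u)) t (complex.Im l).

Definition cderive (R : realType) (g : R -> R[i]) (x : R) (l : R[i]) : Prop :=
  is_derive x 1 (fun u => complex.Re (g u)) (complex.Re l) /\
  is_derive x 1 (fun u => complex.Im (g u)) (complex.Im l).

Definition jointly_continuous (R : realType) (D : set R) (v : R -> R -> R[i])
    : Prop :=
  {within D `*` setT, continuous (fun p : R * R => complex.Re (v p.1 p.2))} /\
  {within D `*` setT, continuous (fun p : R * R => complex.Im (v p.1 p.2))}.

(* v is of class C^{1,2} on D x R, with partial derivatives vt (first
   variable), va and vaa (second variable). *)
Definition class_C12 (R : realType) (D : set R) (v vt va vaa : R -> R -> R[i])
    : Prop :=
  [/\ forall t a, D t -> cderive_within D (v ^~ a) t (vt t a),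
      forall t a, D t -> cderive (v t) a (va t a),
      forall t a, D t -> cderive (va t) a (vaa t a) &
      [/\ jointly_continuous D v, jointly_continuous D vt,
          jointly_continuous D va & jointly_continuous D vaa]].

(* - w_t + f''(t) a w = 1/2 w_aa on D x R; f2 stands for f''. *)
Definition pde_solution (R : realType) (D : set R) (f2 : R -> R)
    (w : R -> R -> R[i]) : Prop :=
  exists wt wa waa : R -> R -> R[i],
    class_C12 D w wt wa waa /\
    forall t a, D t ->
      - wt t a + (f2 t * a)%:C * w t a = 2^-1 * waa t a.

Definition heat_solution (R : realType) (T : set R) (om : R -> R -> R[i])
    : Prop :=
  exists omt omx omxx : R -> R -> R[i],
    class_C12 T om omt omx omxx /\
    forall tau x, T tau -> omt tau x = 2^-1 * omxx tau x.

Definition drift (R : realType) (f1 : R -> R) (s t : R) : R :=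
  \int[@lebesgue_measure R]_(u in `[t, s]) f1 u.

Definition prefactor (R : realType) (f1 : R -> R) (s t a : R) : R :=
  expR (2^-1 * (\int[@lebesgue_measure R]_(u in `[t, s]) (f1 u) ^+ 2)
        + a * f1 t).

Definition heat_integrand (R : realType) (Pi : R -> R[i]) (tau x y : R)
    : R[i] :=
  Pi y * cexp ((- (2^-1 * y ^+ 2 * tau)) +i* (y * x)).

Definition heat_integral (R : realType) (Pi : R -> R[i]) (tau x : R) : R[i] :=
  ((2 * pi)^-1)%:C * cintegral (heat_integrand Pi tau x).

Definition w_formula (R : realType) (f1 : R -> R) (s : R) (Pi : R -> R[i])
    (t a : R) : R[i] :=
  (prefactor f1 s t a)%:C * heat_integral Pi (s - t) (a + drift f1 s t).

Definition admissible (R : realType) (D : set R) (f1 : R -> R) (s : R)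
    (Pi : R -> R[i]) : Prop :=
  forall t a, D t ->
    cintegrable (heat_integrand Pi (s - t) (a + drift f1 s t)).

(* At each time t the function a |-> e^{- a f'(t)} w(t,a) is a Fourier integral
     1/(2 pi) \int W(t,y) e^{iya} dy
   whose amplitude W(t,.) is an arbitrary element of L^1, with L^1-norms locally
   bounded in t. *)
Definition fourier_representable (R : realType) (D : set R) (f1 : R -> R)
    (w : R -> R -> R[i]) : Prop :=
  exists W : R -> R -> R[i],
    [/\ forall t, D t -> cintegrable (W t),
        forall K, compact K -> K `<=` D -> exists M : R, forall t, K t ->
          \int[@lebesgue_measure R]_y Normc.normc (W t y) <= M &
        forall t a, D t ->
          w t a = (expR (a * f1 t))%:C * (((2 * pi)^-1)%:C *
                    cintegral (fun y => W t y * cexp (0 +i* (y * a))))].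

(* Main.v *)
Require Import Defs.
From HB Require Import structures.
From mathcomp Require Import all_boot all_order all_algebra.
From mathcomp Require Import all_classical all_reals all_analysis.
From mathcomp.real_closed Require Import complex.
From mathcomp Require Import measurable_realfun ring lra.
Set Implicit Arguments.
Unset Strict Implicit.
Unset Printing Implicit Defensive.
Import Order.TTheory GRing.Theory Num.Theory.
Import numFieldNormedType.Exports.
Local Open Scope classical_set_scope.
Local Open Scope ring_scope.
Local Open Scope complex_scope.

(* With [c t = (1/2) \int_t^s f'^2] and [A t = \int_t^s f'], the substitution
   [w t a = exp (c t + a f' t) * om (s - t) (a + A t)] turns the equation into
   the heat equation; the inverse substitution has the same shape, so a single
   chain-rule computation serves both directions. Differentiating under the
   integral sign shows that the Fourier integrals of the first line are heat
   solutions. Conversely, if [om] is at each time the Fourier transform of some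
   [V tau] in L^1, with locally bounded norms, then [om] is bounded on strips,
   so the maximum principle identifies it, after time [tau0], with the Fourier
   integral evolved from its own value at [tau0]. Injectivity of the Fourier
   transform on L^1 gives [V tau y = V tau0 y * exp (- y^2 (tau - tau0) / 2)]
   for almost every [y], that is, [Pi y = V tau0 y * exp (y^2 tau0 / 2)]. *)

(** * Injectivity of the Fourier transform on L^1 *)

(** Uniqueness for the heat equation fails without growth control, so the Fourier hypothesis is what
    makes the converse possible: locally bounded L^1-norms bound the solution on each strip of
    times, and boundedness is all that the maximum principle asks for. The amplitude [Pi] itself
    need not be integrable, since going back to time 0 multiplies by [exp (y^2 tau0 / 2)]; hence
    integrability is stated with a Gaussian weight, and differentiation is paid for by a strictly
    earlier weight, available because the set of times [T] is stable under halving. Injectivity on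
    L^1 avoids an inversion formula: a function orthogonal to all cosines with phase stays so when
    multiplied by a trigonometric polynomial, suitable trigonometric polynomials tend boundedly to
    the indicator of a half-line, and a function whose primitive vanishes is zero almost everywhere.
    Complex quantities are treated as pairs of real ones; a cosine with a free phase covers sine and
    cosine at once, and a derivative in [x] only shifts that phase and brings out a factor [y]. *)

Section Integration.
Context d (T : measurableType d) (R : realType).
Variable mu : {measure set T -> \bar R}.

Lemma dominated_Rintegral_cvg (D : set T) (f_ : nat -> T -> R) (f g : T -> R) :
  measurable D -> (forall n, measurable_fun D (f_ n)) -> measurable_fun D f ->
  {ae mu, forall y, D y -> f_ n y @[n --> \oo] --> f y} ->
  mu.-integrable D (EFin \o g) ->
  (forall n y, D y -> `|f_ n y| <= g y) ->
  \int[mu]_(y in D) f_ n y @[n --> \oo] --> \int[mu]_(y in D) f y.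
Proof.
move=> mD mf_ mf f_f ig fg.
have [||||iF _ cF] := @dominated_convergence _ _ _ mu D mD
  (fun n => EFin \o f_ n) (EFin \o f) (EFin \o g) _ _ _ ig.
- by move=> n; exact: ((measurable_EFinP _ _).2 (mf_ n)).
- exact/measurable_EFinP.
- case: f_f => N [mN N0 sN]; exists N; split => // y /= h; apply: sN => /= h'.
  by apply: h => Dy; apply: cvg_EFin; [exact: nearW | exact: h'].
- by apply: aeW => y n Dy; rewrite /= lee_fin fg.
apply: fine_cvg; rewrite fineK //; exact: integrable_fin_num.
Qed.

Lemma integrableM_bounded (D : set T) (q m : T -> R) (C : R) : measurable D ->
  mu.-integrable D (EFin \o q) -> measurable_fun D m ->
  (forall y, D y -> `|m y| <= C) ->
  mu.-integrable D (EFin \o (fun y => q y * m y)).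
Proof.
move=> mD iq mm mC.
have /integrableP[mq _] := iq.
apply: (le_integrable mD (g := EFin \o (fun y => C * q y))).
- by apply/measurable_EFinP/measurable_funM => //; exact/measurable_EFinP.
- move=> y Dy /=; rewrite lee_fin !normrM mulrC ler_wpM2r//.
  exact: le_trans (mC _ Dy) (ler_norm _).
- exact: (@integrableZl _ _ _ _ _ mD C (EFin \o q)).
Qed.

Lemma integrable_lin (D : set T) (k l : R) (p q : T -> R) : measurable D ->
  mu.-integrable D (EFin \o p) -> mu.-integrable D (EFin \o q) ->
  mu.-integrable D (EFin \o (fun y => k * p y + l * q y)).
Proof.
move=> mD ip iq.
exact: (@integrableD _ _ _ _ _ mD (EFin \o (fun y => k * p y))
  (EFin \o (fun y => l * q y)) (integrableZl mD k ip) (integrableZl mD l iq)).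
Qed.

Lemma Rintegral_lin (D : set T) (k l : R) (p q : T -> R) : measurable D ->
  mu.-integrable D (EFin \o p) -> mu.-integrable D (EFin \o q) ->
  \int[mu]_(y in D) (k * p y + l * q y) =
  k * \int[mu]_(y in D) p y + l * \int[mu]_(y in D) q y.
Proof.
move=> mD ip iq.
rewrite RintegralD ?RintegralZl//; first exact: (integrableZl mD k ip).
exact: (integrableZl mD l iq).
Qed.

End Integration.

Section FourierUniqueness.
Context {R : realType}.
Local Notation mu := (@lebesgue_measure R).

(** The free phase [b] joins the cosine and sine transforms in one condition, and it makes the class
    stable under multiplication by any cosine of an affine function. *)
Definition fourier_null (q : R -> R) : Prop :=
  mu.-integrable setT (EFin \o q) /\
  forall x b, \int[mu]_y (q y * cos (x * y + b)) = 0.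

Lemma measurable_cos_affine (x b : R) :
  measurable_fun setT (fun y : R => cos (x * y + b)).
Proof.
apply: continuous_measurable_fun => y.
apply: continuous_comp; last exact: continuous_cos.
by apply: cvgD; [apply: cvgM; [exact: cvg_cst|exact: cvg_id]|exact: cvg_cst].
Qed.

Lemma integrable_cosM (q : R -> R) (x b : R) :
  mu.-integrable setT (EFin \o q) ->
  mu.-integrable setT (EFin \o (fun y => q y * cos (x * y + b))).
Proof.
move=> iq; apply: (integrableM_bounded (C := 1)) => //.
  exact: measurable_cos_affine.
by move=> y _; exact: cos_max.
Qed.

Lemma fourier_null_lin (k l : R) (q1 q2 : R -> R) :
  fourier_null q1 -> fourier_null q2 ->
  fourier_null (fun y => k * q1 y + l * q2 y).
Proof.
move=> [i1 n1] [i2 n2]; split; first exact: integrable_lin.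
move=> x b; under eq_Rintegral do rewrite mulrDl -!mulrA.
rewrite Rintegral_lin ?n1 ?n2 ?mulr0 ?addr0//; exact: integrable_cosM.
Qed.

Lemma fourier_nullM_cos (q : R -> R) (al be : R) :
  fourier_null q -> fourier_null (fun y => q y * cos (al * y + be)).
Proof.
move=> [iq nq]; split; first exact: integrable_cosM.
move=> x b.
have E y : q y * cos (al * y + be) * cos (x * y + b) =
    2^-1 * (q y * cos ((x + al) * y + (b + be))) +
    2^-1 * (q y * cos ((x - al) * y + (b - be))).
  have -> : (x + al) * y + (b + be) = (x * y + b) + (al * y + be) by ring.
  have -> : (x - al) * y + (b - be) = (x * y + b) - (al * y + be) by ring.
  by move: (x * y + b) (al * y + be) => A B; rewrite cosB cosD; field.
under eq_Rintegral do rewrite E.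
rewrite Rintegral_lin ?nq ?mulr0 ?addr0//; exact: integrable_cosM.
Qed.

Lemma bernoulli_ge (x : R) n : -1 <= x -> 1 + n%:R * x <= (1 + x) ^+ n.
Proof.
move=> x1; elim: n => [|n IH]; first by rewrite mul0r addr0 expr0.
rewrite exprS; have h : 0 <= 1 + x by lra.
apply: le_trans (ler_wpM2l h IH).
rewrite -natr1; have : 0 <= n%:R * x ^+ 2 by rewrite mulr_ge0 ?ler0n ?sqr_ge0.
by nra.
Qed.

(* Brosowski-Deutsch polynomials: on the unit interval, away from [v = 1/2],
   they converge to the indicator of [v < 1/2]. *)
Definition step_poly (n : nat) (v : R) : R := (1 - v ^+ n) ^+ (2 ^ n)%N.

Lemma step_poly_itv n (v : R) : 0 <= v <= 1 -> 0 <= step_poly n v <= 1.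
Proof.
move=> /andP[v0 v1]; have h : 0 <= 1 - v ^+ n <= 1.
  by rewrite subr_ge0 exprn_ile1//= lerBlDr lerDl exprn_ge0.
case/andP: h => h0 h1.
by rewrite exprn_ge0//= exprn_ile1.
Qed.

(** Since $(1 - v^n)(1 + v^n) \le 1$, the polynomial is at most the inverse of $(1 + v^n)^{2^n}$,
    and Bernoulli bounds the latter below by $1 + (2v)^n = 1 + (1+t)^n$, hence by $1 + nt$. *)
Lemma step_poly_high n (t : R) : 0 <= t <= 1 ->
  step_poly n ((1 + t) / 2) <= (1 + n%:R * t)^-1.
Proof.
move=> /andP[t0 t1]; set v := (1 + t) / 2.
have v0 : 0 <= v by rewrite /v; lra.
have v1 : v <= 1 by rewrite /v; lra.
have vn0 : 0 <= v ^+ n by exact: exprn_ge0.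
have vn1 : v ^+ n <= 1 by exact: exprn_ile1.
have P0 : 0 < 1 + n%:R * t by rewrite ltr_pwDl// mulr_ge0.
rewrite /step_poly -[leRHS]mul1r ler_pdivlMr//.
have B : 1 + n%:R * t <= (1 + v ^+ n) ^+ (2 ^ n)%N.
  apply: le_trans (bernoulli_ge _ _); last by lra.
  rewrite natrX -exprMn (_ : 2 * v = 1 + t); last by rewrite /v; field.
  by apply: le_trans (@bernoulli_ge t n _) _; [lra|rewrite lerDr].
have h0 : 0 <= (1 - v ^+ n) ^+ (2 ^ n)%N by apply: exprn_ge0; lra.
apply: le_trans (ler_wpM2l h0 B) _.
rewrite -exprMn exprn_ile1//; first nra.
by nra.
Qed.

(** Bernoulli gives $1 - (1 - v^n)^{2^n} \le (2v)^n = (1-t)^n$, and $(1-t)^n (1+nt) \le (1-t^2)^n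
    \le 1$. *)
Lemma step_poly_low n (t : R) : 0 <= t <= 1 ->
  1 - step_poly n ((1 - t) / 2) <= (1 + n%:R * t)^-1.
Proof.
move=> /andP[t0 t1]; set v := (1 - t) / 2.
have v0 : 0 <= v by rewrite /v; lra.
have v1 : v <= 1 by rewrite /v; lra.
have vn1 : v ^+ n <= 1 by exact: exprn_ile1.
have P0 : 0 < 1 + n%:R * t by rewrite ltr_pwDl// mulr_ge0.
have := @bernoulli_ge (- v ^+ n) (2 ^ n)%N; rewrite lerN2 => /(_ vn1).
rewrite natrX mulrN -exprMn -/(step_poly n v) (_ : 2 * v = 1 - t); last first.
  by rewrite /v; field.
move=> h.
apply: le_trans (_ : (1 - t) ^+ n <= _); first by move: h; lra.
rewrite -[leRHS]mul1r ler_pdivlMr//.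
have h0 : 0 <= (1 - t) ^+ n by apply: exprn_ge0; lra.
have B : 1 + n%:R * t <= (1 + t) ^+ n by apply: bernoulli_ge; lra.
apply: le_trans (ler_wpM2l h0 B) _.
by rewrite -exprMn exprn_ile1//; nra.
Qed.

Lemma fourier_null_step (q : R -> R) (al be : R) n : fourier_null q ->
  fourier_null (fun y => q y * step_poly n ((1 - cos (al * y + be)) / 2)).
Proof.
have mulv r : fourier_null r ->
    fourier_null (fun y => r y * ((1 - cos (al * y + be)) / 2)).
  move=> nr; have := fourier_null_lin 2^-1 (- 2^-1) nr (fourier_nullM_cos al be nr).
  by congr fourier_null; apply/funext => y; field.
have mulvn k r : fourier_null r ->
    fourier_null (fun y => r y * (((1 - cos (al * y + be)) / 2) ^+ k)).
  elim: k r => [|k IH] r nr; first by under eq_fun do rewrite expr0 mulr1.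
  by under eq_fun do rewrite exprS mulrA; apply: IH; exact: mulv.
(* The function [q] is generalized, so that each factor [1 - v ^+ n] is absorbed into it and the
   trigonometric polynomial never has to be expanded. *)
rewrite /step_poly; elim: (2 ^ n)%N q => [|k IH] q nq.
  by under eq_fun do rewrite expr0 mulr1.
under eq_fun do rewrite exprS mulrA; apply: IH.
have := fourier_null_lin 1 (-1) nq (mulvn n q nq).
by congr fourier_null; apply/funext => y; ring.
Qed.

Lemma sin_ge_half : exists2 e : R, 0 < e <= 1 & forall x, 0 <= x < e -> x / 2 <= sin x.
Proof.
have : \forall x \near (0 : R), 2^-1 < cos x.
  have : cos x @[x --> (0 : R)] --> (1 : R) by rewrite -cos0; exact: continuous_cos.
  by move=> /cvgr_gt; apply; rewrite invf_lt1// ltr1n.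
move=> /nbhs_ballP[e /= e0 He].
exists (Num.min e 1); first by rewrite lt_min e0 ltr01 ge_min lexx orbT.
move=> x /andP[]; rewrite le_eqVlt lt_min => /predU1P[<- _|x0 /andP[xe _]].
  by rewrite mul0r sin0.
have dsin y : y \in `]0, x[ -> is_derive y 1 sin (cos y) by move=> _; exact: is_derive_sin.
have csin : {within `[0, x], continuous (@sin R)}.
  by apply: continuous_subspaceT => y; exact: continuous_sin.
have [c /[!in_itv]/= /andP[c0 cx]] := MVT x0 dsin csin.
rewrite sin0 !subr0 => ->; rewrite mulrC ler_pM2r// ltW// He//.
by rewrite /ball/= sub0r normrN gtr0_norm//; lra.
Qed.

(** Once [d / m.+1] is small, its sine is at least half of it; the degree [m.+1 ^ 2] then outweighs
    the denominator [m.+1], leaving a quantity of order [d / 2 * m]. *)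
Lemma near_step_sin (d : R) : 0 < d -> \forall m \near \oo,
  0 <= sin (d / m.+1%:R) <= 1 /\
  (1 + (m.+1 ^ 2)%:R * sin (d / m.+1%:R))^-1 <= (1 + d / 2 * m%:R)^-1.
Proof.
move=> d0; have [e /andP[e0 e1] He] := sin_ge_half.
near=> m.
have M0 : 0 < m.+1%:R :> R by rewrite ltr0n.
have h0 : 0 <= d / m.+1%:R by rewrite divr_ge0// ltW.
have : d / m.+1%:R / 2 <= sin (d / m.+1%:R).
  apply: He; rewrite h0/= ltr_pdivrMr// -ltr_pdivrMl//.
  apply: lt_trans (_ : m%:R < _); last by rewrite ltr_nat.
  near: m; exact: nbhs_infty_gtr.
move=> hs; have s0 : 0 <= sin (d / m.+1%:R) by apply: le_trans hs; rewrite divr_ge0.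
rewrite sin_le1 andbT; split => //.
rewrite lef_pV2 ?posrE; last 2 first.
- by rewrite ltr_pwDl// mulr_ge0.
- by rewrite ltr_pwDl// mulr_ge0// divr_ge0// ltW.
rewrite lerD2l; apply: le_trans (_ : (m.+1 ^ 2)%:R * (d / m.+1%:R / 2) <= _); last first.
  by rewrite ler_wpM2l.
rewrite natrX [leRHS](_ : _ = d / 2 * m.+1%:R); last first.
  by move: M0; move: (m.+1%:R) => M M0; field; rewrite gt_eqF.
by rewrite ler_wpM2l ?ler_nat// divr_ge0// ltW.
Unshelve. all: by end_near. Qed.

Lemma cvg_inv_affine (c : R) : 0 < c -> (1 + c * m%:R)^-1 @[m --> \oo] --> (0 : R).
Proof.
move=> c0; apply/cvgrPdist_lt => e e0; near=> m.
have p : 0 < 1 + c * m%:R by rewrite ltr_pwDl// mulr_ge0// ltW.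
rewrite sub0r normrN gtr0_norm ?invr_gt0//.
rewrite -[ltLHS]mul1r ltr_pdivrMr// mulrDr mulr1 mulrA.
apply: lt_trans (_ : e * c * m%:R < _); last by rewrite ltrDr.
rewrite -ltr_pdivrMl ?mulr_gt0//.
near: m; exact: nbhs_infty_gtr.
Unshelve. all: by end_near. Qed.

(* The period [2 pi (m + 1)] of the phase grows more slowly than the degree
   [(m + 1)^2], so one limit turns a periodic step into a genuine one. *)
Lemma step_sin_cvg (z y : R) : y != z ->
  step_poly (m.+1 ^ 2) ((1 - sin ((z - y) / m.+1%:R)) / 2) @[m --> \oo] -->
  (\1_(`]-oo, z]) y : R).
Proof.
move=> yz.
have -> : \1_(`]-oo, z]) y = ((y <= z)%R)%:R :> R by rewrite indicE mem_setE in_itv.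
apply/subr_cvg0.
have [zy|yz'] := ltP z y.
- pose c := (y - z) / 2; have c0 : 0 < c by rewrite /c divr_gt0// subr_gt0.
  apply: norm_cvg0; apply: (@squeeze_cvgr _ _ _ _ (cst 0) (fun m => (1 + c * m%:R)^-1));
    [|exact: cvg_cst|exact: cvg_inv_affine].
  have /near_step_sin : 0 < y - z by rewrite subr_gt0.
  apply: filterS => m [st sl].
  rewrite normr_ge0/= subr0.
  have -> : (z - y) / m.+1%:R = - ((y - z) / m.+1%:R) by rewrite -mulNr opprB.
  rewrite sinN opprK.
  rewrite ger0_norm; first exact: le_trans (step_poly_high _ st) sl.
  by have /andP[] := @step_poly_itv (m.+1 ^ 2) ((1 + sin ((y - z) / m.+1%:R)) / 2)
    ltac:(lra).
- have zy : y < z by rewrite lt_neqAle yz yz'.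
  pose c := (z - y) / 2; have c0 : 0 < c by rewrite /c divr_gt0// subr_gt0.
  apply: norm_cvg0; apply: (@squeeze_cvgr _ _ _ _ (cst 0) (fun m => (1 + c * m%:R)^-1));
    [|exact: cvg_cst|exact: cvg_inv_affine].
  have /near_step_sin : 0 < z - y by rewrite subr_gt0.
  apply: filterS => m [st sl].
  rewrite normr_ge0/= distrC.
  rewrite ger0_norm; first exact: le_trans (step_poly_low _ st) sl.
  rewrite subr_ge0.
  by have /andP[] := @step_poly_itv (m.+1 ^ 2) ((1 - sin ((z - y) / m.+1%:R)) / 2)
    ltac:(lra).
Qed.

(** Multiplied by the trigonometric steps, [p] stays null, so its integral (frequency 0, phase 0)
    vanishes; dominated convergence with bound [|p|] passes to the indicator of the half-line. *)
Lemma fourier_null_ray (p : R -> R) (z : R) : fourier_null p ->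
  \int[mu]_(y in `]-oo, z]) p y = 0.
Proof.
move=> np; have [ip _] := np.
pose th m y := step_poly (m.+1 ^ 2) ((1 - sin ((z - y) / m.+1%:R)) / 2).
(* A phase shift by [pi / 2] rewrites the sine as the cosine of an affine function, the form that
   [fourier_null_step] accepts. *)
have thE m y : th m y = step_poly (m.+1 ^ 2)
    ((1 - cos (- (m.+1%:R)^-1 * y + (z / m.+1%:R - pi / 2))) / 2).
  rewrite /th -cosBpihalf; congr (step_poly _ ((1 - cos _) / 2)); ring.
have nth m : fourier_null (fun y => p y * th m y).
  under eq_fun do rewrite thE; exact: fourier_null_step.
have mp : measurable_fun setT p by have /integrableP[/measurable_EFinP] := ip.
have c1 : \int[mu]_y (p y * th m y) @[m --> \oo] -->
          \int[mu]_y (p y * \1_(`]-oo, z]) y).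
  apply: (@dominated_Rintegral_cvg _ _ _ mu setT (fun m y => p y * th m y)
    (fun y => p y * \1_(`]-oo, z]) y) (fun y => `|p y|)) => //.
  - by move=> m; have /integrableP[/measurable_EFinP] := (nth m).1.
  - by apply: measurable_funM => //; exact: measurable_indic.
  (* The steps converge everywhere except possibly at the jump [z]. *)
  - exists [set z]; split => //; first exact: lebesgue_measure_set1.
    move=> y /= /not_implyP[_]; apply: contra_notP => /eqP yz.
    by apply: cvgM; [exact: cvg_cst|exact: step_sin_cvg].
  - exact: (integrable_norm ip).
  - move=> m y _; rewrite normrM ler_piMr//.
    have h : 0 <= (1 - sin ((z - y) / m.+1%:R)) / 2 <= 1.
      have := sin_le1 ((z - y) / m.+1%:R); have := sin_geN1 ((z - y) / m.+1%:R); lra.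
    by have /andP[h0 h1] := step_poly_itv (m.+1 ^ 2) h; rewrite ger0_norm.
have c0 : \int[mu]_y (p y * th m y) @[m --> \oo] --> (0 : R).
  rewrite (_ : (fun m => _) = cst 0); first exact: cvg_cst.
  apply/funext => m; have [_ /(_ 0 0)] := nth m.
  by under eq_Rintegral do rewrite mul0r add0r cos0 mulr1.
rewrite Rintegral_mkcond (_ : \int[mu]_y _ = \int[mu]_y (p y * \1_(`]-oo, z]) y)).
  exact: (cvg_unique _ c1 c0).
by apply: eq_Rintegral => y _; rewrite patchE indicE; case: ifP; rewrite ?mulr1 ?mulr0.
Qed.

(** By Lebesgue differentiation [p] is almost everywhere the derivative of its primitive from
    $-\infty$, and that primitive is identically zero. *)
Lemma fourier_null_ae0 (p : R -> R) : fourier_null p -> {ae mu, forall y, p y = 0}.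
Proof.
move=> np; have [ip _] := np.
have ip' y : mu.-integrable `]-oo, y] (EFin \o p) by exact: (integrableS measurableT).
have := FTC1Ny ip' (open_integrable_locally openT ip).
apply: filterS; first exact: (ae_filter_ringOfSetsType mu).
move=> y [_ <-].
rewrite (_ : (fun x : R => _) = cst 0); first by rewrite derive1_cst.
by apply/funext => x; exact: fourier_null_ray.
Qed.

End FourierUniqueness.

(** * Gaussian Fourier integrals *)

Section UnderIntegral.
Context d (T : measurableType d) (R : realType).
Variable mu : {measure set T -> \bar R}.

Lemma is_derive_under_integral (f df : R -> T -> R) (a u v : R) (G : T -> R) :
  a \in `]u, v[ ->
  (forall x, x \in `]u, v[ -> mu.-integrable setT (EFin \o f x)) ->
  (forall x y, x \in `]u, v[ -> is_derive x 1 (f ^~ y) (df x y)) ->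
  mu.-integrable setT (EFin \o G) ->
  (forall x y, x \in `]u, v[ -> `|df x y| <= G y) ->
  is_derive a 1 (fun x => \int[mu]_y f x y) (\int[mu]_y df a y).
Proof.
move=> Ia intf derf intG G_ub.
have G0 y : 0 <= G y by exact: le_trans (normr_ge0 _) (G_ub a y Ia).
have dE x y : x \in `]u, v[ -> partial1of2 f x y = df x y.
  by move=> /derf => /(_ y) [_ h]; rewrite partial1of2E.
have derf1 x y : `]u, v[%classic x -> [set: T] y -> derivable (f ^~ y) x 1.
  by move=> /derf => /(_ y) [h _ _].
have ub x y : `]u, v[%classic x -> [set: T] y -> `|partial1of2 f x y| <= G y.
  by move=> Ix _; rewrite dE//; exact: G_ub.
apply: DeriveDef.
  exact: (derivable_under_integral measurableT Ia intf derf1 G0 intG ub).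
rewrite -derive1E.
rewrite (differentiation_under_integral measurableT Ia intf derf1 G0 intG ub).
by apply: eq_Rintegral => y _; exact: dE.
Qed.

End UnderIntegral.

Section Heat.
Context {R : realType}.
Local Notation mu := (@lebesgue_measure R).

(** Dominated convergence speaks of sequences, so joint continuity is reduced to sequences: a
    failure would give, by choice, a bad point of [A] in each ball of radius [n.+1%:R^-1]. *)
Lemma within_continuous_seq (f : R * R -> R) (A : set (R * R)) :
  (forall p (u : nat -> R * R), A p -> (forall n, A (u n)) ->
    (fst (u n)) @[n --> \oo] --> p.1 -> (snd (u n)) @[n --> \oo] --> p.2 ->
    f (u n) @[n --> \oo] --> f p) ->
  {within A, continuous f}.
Proof.
move=> H; apply/subspace_continuousP => p Ap; apply/cvgrPdist_lt => e e0.
apply: contrapT => /= nH.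
have : forall n : nat, exists q, [/\ A q, ball p (n.+1%:R^-1) q & e <= `|f p - f q|].
  move=> n; apply: contrapT => /forallNP h; apply: nH.
  apply/nbhs_ballP; exists n.+1%:R^-1 => //= q bq Aq.
  by rewrite ltNge; apply/negP => le; apply: (h q).
move=> /choice[u /all_and3[Au bu eu]].
have b0 (k : nat) (c : R) : 0 < c -> exists N, forall n, (N <= n)%N -> n.+1%:R^-1 < c.
  move=> c0; have := @near_infty_natSinv_lt R (PosNum c0).
  by move=> [N _ HN]; exists N => n /HN.
have c1 : (fst (u n)) @[n --> \oo] --> p.1.
  apply/cvgrPdist_lt => c /(b0 0%N)[N HN]; exists N => // n /= /HN.
  by have [h _] := bu n; exact: lt_trans.
have c2 : (snd (u n)) @[n --> \oo] --> p.2.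
  apply/cvgrPdist_lt => c /(b0 0%N)[N HN]; exists N => // n /= /HN.
  by have [_ h] := bu n; exact: lt_trans.
have /cvgrPdist_lt/(_ _ e0)[N _ /(_ N (leqnn N))/=] := H p u Ap Au c1 c2.
by rewrite ltNge eu.
Unshelve. all: by end_near. Qed.

(** This is the kernel on the frequency side, the real part of $e^{ib} e^{-y^2 \tau/2 + iyx}$. With
    [b] among [0] and [pi / 2] up to sign, it yields the real and imaginary parts of every integrand
    below. *)
Definition heat_kernel (tau x b y : R) : R :=
  expR (- (2^-1 * y ^+ 2 * tau)) * cos (y * x + b).

Definition fourier_heat (p : R -> R) (tau x b : R) : R :=
  \int[mu]_y (p y * heat_kernel tau x b y).

(** The weight is part of the condition because [p] may grow like $e^{y^2 \tau_0/2}$ for some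
    $\tau_0 > 0$. *)
Definition gauss_integrable (p : R -> R) (tau : R) : Prop :=
  mu.-integrable setT (EFin \o (fun y => p y * expR (- (2^-1 * y ^+ 2 * tau)))).

Lemma continuous_gauss (tau : R) :
  continuous (fun y : R => expR (- (2^-1 * y ^+ 2 * tau))).
Proof.
move=> y; apply: continuous_comp; last exact: continuous_expR.
apply: cvgN; apply: cvgM; last exact: cvg_cst.
by apply: cvgM; [exact: cvg_cst|exact: exprn_continuous].
Qed.

Lemma measurable_gauss (tau : R) :
  measurable_fun setT (fun y : R => expR (- (2^-1 * y ^+ 2 * tau))).
Proof. by apply: continuous_measurable_fun; exact: continuous_gauss. Qed.

Lemma measurable_heat_kernel (tau x b : R) : measurable_fun setT (heat_kernel tau x b).
Proof.
apply: continuous_measurable_fun => y; apply: cvgM; first exact: continuous_gauss.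
apply: continuous_comp; last exact: continuous_cos.
by apply: cvgD; [apply: cvgM; [exact: cvg_id|exact: cvg_cst]|exact: cvg_cst].
Qed.

(** The Gaussian weight is invertible: the weight with parameter [- tau] undoes it. *)
Lemma gauss_integrable_measurable p tau : gauss_integrable p tau -> measurable_fun setT p.
Proof.
move=> /integrableP[/measurable_EFinP mp _].
rewrite (_ : p = fun y => (p y * expR (- (2^-1 * y ^+ 2 * tau))) *
    expR (- (2^-1 * y ^+ 2 * (- tau)))).
  by apply: measurable_funM => //; exact: measurable_gauss.
apply/funext => y; rewrite -mulrA -expRD.
by rewrite (_ : _ + _ = 0) ?expR0 ?mulr1//; ring.
Qed.

(** The passage from weight [tau0] to weight [tau] pays for a multiplier that grows up to the
    quotient of the two Gaussians. *)
Lemma gauss_integrableM (p m : R -> R) (tau0 tau C : R) :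
  measurable_fun setT m ->
  (forall y, `|m y| <= C * expR (2^-1 * y ^+ 2 * (tau - tau0))) ->
  gauss_integrable p tau0 -> gauss_integrable (fun y => m y * p y) tau.
Proof.
move=> mm mC ip.
rewrite /gauss_integrable (_ : (fun y => _) = (fun y =>
    p y * expR (- (2^-1 * y ^+ 2 * tau0)) *
     (m y * expR (- (2^-1 * y ^+ 2 * (tau - tau0)))))); last first.
  apply/funext => y.
  rewrite (_ : - (2^-1 * y ^+ 2 * tau) = - (2^-1 * y ^+ 2 * tau0) +
    - (2^-1 * y ^+ 2 * (tau - tau0))); last by ring.
  rewrite expRD; ring.
apply: (integrableM_bounded (C := C)) => //.
  by apply: measurable_funM => //; exact: measurable_gauss.
move=> y _; rewrite normrM (ger0_norm (expR_ge0 _)) expRN.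
by rewrite ler_pdivrMr ?expR_gt0.
Qed.

Lemma gauss_integrable_le p tau0 tau : tau0 <= tau ->
  gauss_integrable p tau0 -> gauss_integrable p tau.
Proof.
move=> h ip; have := @gauss_integrableM p (cst 1) tau0 tau 1.
rewrite (_ : (fun y => _) = p); last by apply/funext => y; rewrite /= mul1r.
apply => // y; rewrite normr1 mul1r -expR0 ler_expR.
by apply: mulr_ge0; [rewrite mulr_ge0 ?sqr_ge0|rewrite subr_ge0].
Qed.

(** With $z = y^2 \delta/2$ one has $y^2 = (2/\delta) z$, whence the constant: $1 + (2/\delta) z \le
    (1 + 2/\delta)(1 + z)$ and $1 + z \le e^z$. The summand 1 lets the same bound serve the
    multipliers $y$ and $y^2$. *)
Lemma sqr_le_expR (dl y : R) : 0 < dl ->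
  1 + y ^+ 2 <= (1 + 2 / dl) * expR (2^-1 * y ^+ 2 * dl).
Proof.
move=> d0; set z := 2^-1 * y ^+ 2 * dl.
have zE : y ^+ 2 = 2 / dl * z by rewrite /z; field; rewrite gt_eqF.
have z0 : 0 <= z by apply: mulr_ge0; [rewrite mulr_ge0 ?sqr_ge0|exact: ltW].
have k0 : 0 < 2 / dl by rewrite divr_gt0.
rewrite zE; apply: le_trans (_ : (1 + 2 / dl) * (1 + z) <= _).
  by move: (2 / dl) k0 => k k0; nra.
by apply: ler_wpM2l; [lra|exact: expR_ge1Dx].
Qed.

Lemma gauss_integrable_sqr p tau0 tau : tau0 < tau ->
  gauss_integrable p tau0 -> gauss_integrable (fun y => y ^+ 2 * p y) tau.
Proof.
move=> h; apply: (@gauss_integrableM p _ tau0 tau (1 + 2 / (tau - tau0))).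
  by apply: continuous_measurable_fun => y; exact: exprn_continuous.
move=> y; apply: le_trans (sqr_le_expR y _); last by rewrite subr_gt0.
by rewrite ger0_norm ?sqr_ge0// lerDr.
Qed.

Lemma gauss_integrable_id p tau0 tau : tau0 < tau ->
  gauss_integrable p tau0 -> gauss_integrable (fun y => y * p y) tau.
Proof.
move=> h; apply: (@gauss_integrableM p _ tau0 tau (1 + 2 / (tau - tau0))) => //.
move=> y; apply: le_trans (sqr_le_expR y _); last by rewrite subr_gt0.
have := sqr_ge0 (y + 1 / 2); have := sqr_ge0 (y - 1 / 2).
by rewrite ler_norml => h1 h2; apply/andP; split; nra.
Qed.

Lemma integrable_heat_kernel p tau x b : gauss_integrable p tau ->
  mu.-integrable setT (EFin \o (fun y => p y * heat_kernel tau x b y)).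
Proof.
move=> ip; under eq_fun do rewrite /heat_kernel mulrA.
apply: (integrableM_bounded (C := 1)) => //; last by move=> y _; exact: cos_max.
apply: continuous_measurable_fun => y.
apply: continuous_comp; last exact: continuous_cos.
by apply: cvgD; [apply: cvgM; [exact: cvg_id|exact: cvg_cst]|exact: cvg_cst].
Qed.

Lemma gauss_le (tau0 tau y : R) : tau0 <= tau ->
  expR (- (2^-1 * y ^+ 2 * tau)) <= expR (- (2^-1 * y ^+ 2 * tau0)).
Proof. by move=> h; rewrite ler_expR lerN2 ler_wpM2l// mulr_ge0 ?sqr_ge0. Qed.

Lemma heat_kernel_le (tau0 tau x b y : R) : tau0 <= tau ->
  `|heat_kernel tau x b y| <= expR (- (2^-1 * y ^+ 2 * tau0)).
Proof.
move=> h; rewrite normrM (ger0_norm (expR_ge0 _)).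
apply: le_trans (gauss_le y h).
by rewrite ler_piMr ?expR_ge0// cos_max.
Qed.

Lemma integrable_dominating p tau : gauss_integrable p tau ->
  mu.-integrable setT (EFin \o (fun y => `|p y| * expR (- (2^-1 * y ^+ 2 * tau)))).
Proof.
move=> ip; rewrite (_ : (fun y => _) =
    Num.norm \o (fun y => p y * expR (- (2^-1 * y ^+ 2 * tau)))).
  exact: (integrable_norm ip).
by apply/funext => y /=; rewrite normrM (ger0_norm (expR_ge0 _)).
Qed.

(** The weight at [tau0] dominates the integrand at all later times. The initial time [tau0] is
    included, because the maximum principle needs continuity down to the initial data. *)
Lemma fourier_heat_continuous p tau0 b : gauss_integrable p tau0 ->
  {within [set tau | tau0 <= tau] `*` setT,
    continuous (fun q : R * R => fourier_heat p q.1 q.2 b)}.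
Proof.
move=> ip; apply: within_continuous_seq => -[tau x] u [/= ht _] hu cu1 cu2.
have mp := gauss_integrable_measurable ip.
apply: (@dominated_Rintegral_cvg _ _ _ mu setT
    (fun n y => p y * heat_kernel (u n).1 (u n).2 b y)
    (fun y => p y * heat_kernel tau x b y)
    (fun y => `|p y| * expR (- (2^-1 * y ^+ 2 * tau0)))) => //.
- by move=> n; apply: measurable_funM => //; exact: measurable_heat_kernel.
- by apply: measurable_funM => //; exact: measurable_heat_kernel.
- apply: aeW => y _; apply: cvgM; first exact: cvg_cst.
  apply: cvgM.
    apply: continuous_cvg; first exact: continuous_expR.
    by apply: cvgN; apply: cvgM => //; exact: cvg_cst.
  apply: continuous_cvg; first exact: continuous_cos.
  by apply: cvgD; [apply: cvgM => //; exact: cvg_cst|exact: cvg_cst].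
- exact: integrable_dominating.
- move=> n y _; rewrite normrM ler_wpM2l//; apply: heat_kernel_le.
  by have [] := hu n.
Qed.

Lemma is_derive_mull (c t : R) : is_derive t 1 (fun s : R => c * s) c.
Proof.
apply: is_derive_eq (is_deriveZ c (is_derive_id t 1)) _.
by rewrite [LHS]mulr1.
Qed.

Lemma is_derive_gauss (tau y : R) :
  is_derive tau 1 (fun t => expR (- (2^-1 * y ^+ 2 * t)))
    (- (2^-1 * y ^+ 2) * expR (- (2^-1 * y ^+ 2 * tau))).
Proof.
have h := is_derive1_comp (is_derive_expR (- (2^-1 * y ^+ 2) * tau))
  (is_derive_mull (- (2^-1 * y ^+ 2)) tau).
rewrite (_ : (fun t => _) = expR \o (fun s => - (2^-1 * y ^+ 2) * s)); last first.
  by apply/funext => t /=; rewrite mulNr.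
apply: is_derive_eq.
by rewrite [LHS]mulrC; congr (_ * expR _); rewrite mulNr.
Qed.

(** Writing the derivative as a cosine with phase advanced by [pi / 2] keeps it within the family of
    kernels. *)
Lemma is_derive_cos_phase (x b y : R) :
  is_derive x 1 (fun t => cos (y * t + b)) (y * cos (y * x + (b + pi / 2))).
Proof.
have h : is_derive x 1 (fun t => y * t + b) y.
  apply: is_derive_eq (is_deriveD (is_derive_mull y x) (is_derive_cst b x 1)) _.
  exact: addr0.
rewrite [X in is_derive _ _ _ X](_ : _ = - sin (y * x + b) * y).
  exact: (is_derive1_comp (is_derive_cos _) h).
by rewrite addrA cosDpihalf mulrC.
Qed.

Lemma fourier_heat_dx p (tau x b : R) :
  gauss_integrable p tau -> gauss_integrable (fun y => y * p y) tau ->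
  is_derive x 1 (fun z => fourier_heat p tau z b)
    (fourier_heat (fun y => y * p y) tau x (b + pi / 2)).
Proof.
move=> ip iyp.
apply: (@is_derive_under_integral _ _ _ mu
  (fun z y => p y * heat_kernel tau z b y)
  (fun z y => y * p y * heat_kernel tau z (b + pi / 2) y) x (x - 1) (x + 1)
  (fun y => `|y * p y| * expR (- (2^-1 * y ^+ 2 * tau)))).
- by rewrite in_itv/=; apply/andP; split; lra.
- by move=> z _; exact: integrable_heat_kernel.
- move=> z y _.
  have -> : y * p y * heat_kernel tau z (b + pi / 2) y =
     (p y * expR (- (2^-1 * y ^+ 2 * tau))) * (y * cos (y * z + (b + pi / 2))).
    by rewrite /heat_kernel; ring.
  rewrite (_ : (fun z0 => _) = (p y * expR (- (2^-1 * y ^+ 2 * tau))) *: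
      (fun z0 => cos (y * z0 + b))); last first.
    by apply/funext => z0; rewrite /heat_kernel mulrA.
  exact: (is_deriveZ _ (is_derive_cos_phase _ _ _)).
- exact: integrable_dominating.
- by move=> z y _; rewrite normrM ler_wpM2l//; exact: heat_kernel_le.
Qed.

(** The dominating function must work on a whole neighbourhood of [tau], in particular at times
    before [tau]; this is why the integrability is required at a strictly earlier time. *)
Lemma fourier_heat_dtau p (tau0 tau x b : R) : tau0 < tau ->
  gauss_integrable p tau0 -> gauss_integrable (fun y => y ^+ 2 * p y) tau0 ->
  is_derive tau 1 (fun t => fourier_heat p t x b)
    (- (2^-1 * fourier_heat (fun y => y ^+ 2 * p y) tau x b)).
Proof.
move=> ht ip iyp.
have iyp' t : tau0 <= t -> gauss_integrable (fun y => y ^+ 2 * p y) t.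
  by move=> h; exact: gauss_integrable_le iyp.
rewrite [X in is_derive _ _ _ X](_ : _ = \int[mu]_y
    (- 2^-1 * (y ^+ 2 * p y * heat_kernel tau x b y))); last first.
  rewrite RintegralZl ?mulNr//; apply: integrable_heat_kernel.
  by apply: iyp'; exact: ltW.
apply: (@is_derive_under_integral _ _ _ mu
  (fun t y => p y * heat_kernel t x b y)
  (fun t y => - 2^-1 * (y ^+ 2 * p y * heat_kernel t x b y)) tau tau0 (tau + 1)
  (fun y => `|y ^+ 2 * p y| * expR (- (2^-1 * y ^+ 2 * tau0)))).
- by rewrite in_itv/=; apply/andP; split; lra.
- move=> t; rewrite in_itv/= => /andP[h _]; apply: integrable_heat_kernel.
  by apply: gauss_integrable_le ip; exact: ltW.
- move=> t y _.
  have -> : - 2^-1 * (y ^+ 2 * p y * heat_kernel t x b y) =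
     (p y * cos (y * x + b)) *
     (- (2^-1 * y ^+ 2) * expR (- (2^-1 * y ^+ 2 * t))).
    by rewrite /heat_kernel; ring.
  rewrite (_ : (fun t0 => _) = (p y * cos (y * x + b)) *:
      (fun t0 => expR (- (2^-1 * y ^+ 2 * t0)))); last first.
    by apply/funext => t0; rewrite /heat_kernel (mulrC (expR _)) mulrA.
  exact: (is_deriveZ _ (is_derive_gauss _ _)).
- exact: integrable_dominating.
- move=> t y; rewrite in_itv/= => /andP[h _]; rewrite [leLHS]normrM.
  apply: le_trans (_ : 1 * `|y ^+ 2 * p y * heat_kernel t x b y| <= _).
    by rewrite ler_wpM2r// normrN ger0_norm ?invr_ge0//; lra.
  by rewrite mul1r normrM ler_wpM2l//; apply: heat_kernel_le; exact: ltW.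
Qed.

End Heat.

(** * One-sided derivatives and the maximum principle *)

Section DeriveWithin.
Context {R : realType}.
Implicit Types (J : set R) (g h : R -> R) (t l k : R).

Lemma near_within_neq J t : \forall u \near within J t^', u != t.
Proof. by apply/nbhs_ballP; exists 1 => //= u _. Qed.

Lemma near_within_mem J t : \forall u \near within J t^', J u.
Proof. by apply/nbhs_ballP; exists 1 => //= u _. Qed.

Lemma within_dnbhs_cvg J g t : g u @[u --> within J (nbhs t)] --> g t ->
  g u @[u --> within J t^'] --> g t.
Proof.
apply: cvg_trans => A /nbhs_ballP[e /= e0 He].
by apply/nbhs_ballP; exists e => //= u bu _ Ju; exact: He.
Qed.

Lemma cvg_within_dnbhs_id J t : u @[u --> within J t^'] --> t.
Proof.
apply: (@within_dnbhs_cvg J id t); apply: cvg_within_filter; exact: cvg_id.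
Qed.

Lemma derive_within_cvg J g t l : derive_within J g t l ->
  g u @[u --> within J t^'] --> g t.
Proof.
move=> dg.
have c : (g u - g t) / (u - t) * (u - t) + g t @[u --> within J t^'] --> l * (t - t) + g t.
  apply: cvgD; last exact: cvg_cst.
  apply: cvgM; first exact: dg.
  by apply: cvgB; [exact: cvg_within_dnbhs_id|exact: cvg_cst].
rewrite subrr mulr0 add0r in c.
apply: cvg_trans c; apply: near_eq_cvg.
apply: filterS (near_within_neq J t) => u ut.
by rewrite divfK ?subrK// subr_eq0.
Qed.

Lemma within_continuousP J g :
  (forall t, J t -> g u @[u --> within J t^'] --> g t) -> {within J, continuous g}.
Proof.
move=> H; apply/subspace_continuousP => t Jt; apply/cvgrPdist_lt => e e0.
have /cvgrPdist_lt/(_ e e0) /nbhs_ballP[d /= d0 Hd] := H t Jt.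
apply/nbhs_ballP; exists d => //= u bu Ju.
have [->|ut] := eqVneq u t; first by rewrite subrr normr0.
exact: Hd.
Qed.

Lemma derive_within_continuous J g (dg : R -> R) :
  (forall t, J t -> derive_within J g t (dg t)) -> {within J, continuous g}.
Proof. by move=> H; apply: within_continuousP => t /H /derive_within_cvg. Qed.

Lemma derive_within_derive J g t l : is_derive t 1 g l -> derive_within J g t l.
Proof.
move=> /is_derive1_caratheodory[k [kE kc <-]].
have c : k u @[u --> within J t^'] --> k t.
  by apply: within_dnbhs_cvg; exact: cvg_within_filter.
apply: cvg_trans c; apply: near_eq_cvg.
apply: filterS (near_within_neq J t) => u ut.
by rewrite kE mulfK// subr_eq0.
Qed.

Lemma derive_withinD J g h t l k : derive_within J g t l -> derive_within J h t k ->
  derive_within J (fun u => g u + h u) t (l + k).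
Proof.
move=> dg dh.
have c : (g u - g t) / (u - t) + (h u - h t) / (u - t)
    @[u --> within J t^'] --> l + k by apply: cvgD.
apply: cvg_trans c; apply: near_eq_cvg.
by apply: nearW => u; rewrite -mulrDl; congr (_ / _); ring.
Qed.

Lemma derive_withinM J g h t l k : derive_within J g t l -> derive_within J h t k ->
  derive_within J (fun u => g u * h u) t (l * h t + g t * k).
Proof.
move=> dg dh.
have c : (g u - g t) / (u - t) * h u + g t * ((h u - h t) / (u - t))
    @[u --> within J t^'] --> l * h t + g t * k.
  apply: cvgD; first by apply: cvgM => //; exact: derive_within_cvg dh.
  by apply: cvgM => //; exact: cvg_cst.
apply: cvg_trans c; apply: near_eq_cvg.
apply: filterS (near_within_neq J t) => u ut.
by field; rewrite subr_eq0.
Qed.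

Lemma derive_within_comp J g (phi : R -> R) t l k :
  derive_within J g t l -> is_derive (g t) 1 phi k ->
  derive_within J (fun u => phi (g u)) t (k * l).
Proof.
move=> dg /is_derive1_caratheodory[K [KE Kc <-]].
have c : K (g u) * ((g u - g t) / (u - t)) @[u --> within J t^'] --> K (g t) * l.
  apply: cvgM => //; apply: continuous_cvg => //; exact: derive_within_cvg dg.
apply: cvg_trans c; apply: near_eq_cvg.
by apply: nearW => u /=; rewrite mulrA -KE.
Qed.

Lemma cvg_reflect J (s t : R) :
  (s - u) @[u --> within [set u | J (s - u)] t^'] --> within J (s - t)^'.
Proof.
move=> A /nbhs_ballP[e /= e0 He]; apply/nbhs_ballP; exists e => //= u bu ut Ju.
apply: He => //; last by apply: contra_neq ut => /addrI/oppr_inj.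
by move: bu; rewrite /ball/= opprD opprK addrACA subrr add0r addrC distrC.
Qed.

Lemma derive_within_reflect J g (s t l : R) : derive_within J g (s - t) l ->
  derive_within [set u | J (s - u)] (fun u => g (s - u)) t (- l).
Proof.
move=> dg.
have c : - ((g (s - u) - g (s - t)) / ((s - u) - (s - t)))
    @[u --> within [set u | J (s - u)] t^'] --> - l.
  apply: cvgN.
  exact: (cvg_comp _ _ (@cvg_reflect J s t) dg).
apply: cvg_trans c; apply: near_eq_cvg.
apply: filterS (near_within_neq _ t) => u ut.
by field; apply/andP; split; [rewrite subr_eq0|rewrite (_ : _ - _ = t - u) ?subr_eq0 1?eq_sym//; ring].
Qed.

Lemma derive_within_sub J J' g t l : (exists2 e, 0 < e & forall u, `|t - u| < e -> J' u -> J u) ->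
  derive_within J g t l -> derive_within J' g t l.
Proof.
move=> [e e0 He]; apply: cvg_trans; apply: cvg_app => A /nbhs_ballP[d /= d0 Hd].
apply/nbhs_ballP; exists (Num.min e d) => /=; first by rewrite lt_min e0.
move=> u; rewrite /ball/= lt_min => /andP[ue ud] ut Ju.
by apply: Hd => //; exact: He.
Qed.

(** Only difference quotients from the left are tested, so the lemma applies also at the final time
    of a strip. *)
Lemma derive_within_left_max J g (t0 t l : R) : t0 < t -> `]t0, t[ `<=` J ->
  (forall u, t0 < u < t -> g u <= g t) -> derive_within J g t l -> 0 <= l.
Proof.
move=> t0t sJ gmax dg; rewrite leNgt; apply/negP => l0.
have H : nbhs t (fun u => u != t -> J u -> (g u - g t) / (u - t) < 0).
  exact: cvgr_lt _ dg _ l0.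
have [e /= e0 He] := (nbhs_ballP t _).1 H.
pose u := Num.max ((t0 + t) / 2) (t - e / 2).
have ut : u < t by rewrite /u gt_max; apply/andP; split; lra.
have tu : t0 < u by rewrite /u lt_max; apply/orP; left; lra.
have eu : t - e / 2 <= u by rewrite /u le_max lexx orbT.
have : (g u - g t) / (u - t) < 0.
  apply: He; first by rewrite /ball/= gtr0_norm; lra.
    by rewrite lt_eqF.
  by apply: sJ; rewrite /= in_itv/= tu.
apply/negP; rewrite -leNgt -mulrNN -invrN !opprB.
by rewrite mulr_ge0 ?invr_ge0 ?subr_ge0 ?gmax ?tu//= ltW.
Qed.

End DeriveWithin.

(** * The maximum principle on a strip unbounded in space *)

Section MaximumPrinciple.
Context {R : realType}.

(** At a maximum [g1 c = 0]. Were [g2] positive, the Caratheodory slope of [g1] would be positive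
    near [c], so [g1] would be positive just to the right of [c] and [g] would exceed its maximum
    there. *)
Lemma second_derivative_max (g g1 : R -> R) (c g2 : R) :
  (forall x : R, is_derive x 1 g (g1 x)) -> is_derive c 1 g1 g2 ->
  (forall x, g x <= g c) -> g2 <= 0.
Proof.
move=> dg dg1 gmax.
have g1c : g1 c = 0.
  have cI : c \in `]c - 1, c + 1[ by rewrite in_itv/=; apply/andP; split; lra.
  have h : is_derive c 1 g 0.
    apply: (@derive1_at_max _ g (c - 1) (c + 1)) => //; first by lra.
  by have [_ <-] := h; have [_ ->] := dg c.
rewrite leNgt; apply/negP => g20.
have /is_derive1_caratheodory[k [kE kc kg2]] := dg1.
have k0 : 0 < k c by rewrite kg2.
have H : nbhs c (fun u => 0 < k u) by exact: cvgr_gt _ kc _ k0.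
have [e /= e0 He] := (nbhs_ballP c _).1 H.
have ce : c < c + e / 2 by lra.
have dg' x : x \in `]c, (c + e / 2)[ -> is_derive x 1 g (g1 x) by move=> _; exact: dg.
have cg : {within `[c, c + e / 2], continuous g}.
  apply: derivable_within_continuous => x _.
  by have [] := dg x.
have [x /[!in_itv]/= /andP[cx xe] E] := MVT ce dg' cg.
have : 0 < g (c + e / 2) - g c.
  rewrite E; apply: mulr_gt0; last by lra.
  have -> : g1 x = k x * (x - c) by rewrite -kE g1c subr0.
  apply: mulr_gt0; last by rewrite subr_gt0.
  by apply: He; rewrite /ball/= ltr0_norm; lra.
by rewrite subr_gt0 ltNge gmax.
Qed.

(** The bound [M] replaces a lateral boundary condition: it confines the positive values of the
    penalized function to a compact box. The equation is used only after [t0]; at [t0] continuity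
    suffices. *)
Lemma heat_max_principle (t0 t1 M : R) (J : set R) (v vt vx vxx : R -> R -> R) :
  `]t0, t1] `<=` J ->
  {within `[t0, t1] `*` setT, continuous (fun q : R * R => v q.1 q.2)} ->
  (forall t x : R, t0 < t <= t1 -> derive_within J (v ^~ x) t (vt t x)) ->
  (forall t x : R, t0 < t <= t1 -> is_derive x 1 (v t) (vx t x)) ->
  (forall t x : R, t0 < t <= t1 -> is_derive x 1 (vx t) (vxx t x)) ->
  (forall t x : R, t0 < t <= t1 -> vt t x = 2^-1 * vxx t x) ->
  (forall t x, t0 <= t <= t1 -> v t x <= M) ->
  (forall x, v t0 x <= 0) ->
  forall t x, t0 <= t <= t1 -> v t x <= 0.
Proof.
move=> sJ cv dt dx dxx heat vM v0 t x ht.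
(* Barrier: [v - e * (x^2 + 2 (t - t0))] tends to [-oo] in [x] and is a strict
   subsolution. *)
suff H (e : R) : 0 < e -> v t x <= e * (x ^+ 2 + 2 * (t - t0)).
  have P : 0 <= x ^+ 2 + 2 * (t - t0) by have := sqr_ge0 x; lra.
  rewrite leNgt; apply/negP => vp.
  have Q : 0 < x ^+ 2 + 2 * (t - t0) + 1 by lra.
  (* Instead of a limit in [e], one value suffices: with [P = x ^+ 2 + 2 * (t - t0)] it gives
     [v * (P + 1) <= v * P], impossible for [v > 0]. *)
  have /H : 0 < v t x / (x ^+ 2 + 2 * (t - t0) + 1) by rewrite divr_gt0.
  rewrite mulrAC ler_pdivlMr// ler_pM2l//; lra.
move=> e0.
pose z (q : R * R) := v q.1 q.2 - e * (q.2 ^+ 2 + 2 * (q.1 - t0)).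
suff : z (t, x) <= 0 by rewrite subr_le0.
(* The box contains [x], and beyond it the penalty wins: [L >= 1] gives [L * L >= L >= |M| / e], so
   [e * y ^+ 2] exceeds [|M|] when [|y| > L]. *)
pose L : R := 1 + `|x| + `|M| / e.
have Me : 0 <= `|M| / e by rewrite divr_ge0// ltW.
have xL : `|x| <= L by rewrite /L; have := normr_ge0 x; lra.
have outL y u : t0 <= u <= t1 -> L < `|y| -> z (u, y) <= 0.
  move=> hu Ly; rewrite /z/= subr_le0; apply: le_trans (vM _ _ hu) _.
  apply: le_trans (ler_norm M) _; rewrite -ler_pdivrMl// mulrC.
  apply: le_trans (_ : L * L <= _); first by rewrite /L; have := normr_ge0 x; nra.
  have L0 : 0 <= L by rewrite /L; have := normr_ge0 x; lra.
  have yE : y ^+ 2 = `|y| ^+ 2 by rewrite -normrX ger0_norm ?sqr_ge0.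
  have : L * L <= `|y| ^+ 2 by rewrite -expr2 lerXn2r ?nnegrE// ltW.
  by rewrite yE; lra.
pose K := `[t0, t1] `*` `[- L, L].
have cK : compact K by apply: compact_setX; exact: segment_compact.
have Ktx : K (t, x).
  by split; rewrite /= in_itv//= -ler_norml.
have cz : {within K, continuous z}.
  apply/subspace_continuousP => q Kq.
  apply: cvgB.
    have KS : K `<=` `[t0, t1] `*` setT by move=> p [].
    by have /subspace_continuousP := continuous_subspaceW KS cv; exact.
  apply: cvg_within_filter.
  apply: cvgM; first exact: cvg_cst.
  apply: cvgD; first by apply: cvgM; exact: cvg_snd.
  apply: cvgM; first exact: cvg_cst.
  by apply: cvgB; [exact: cvg_fst|exact: cvg_cst].
have [[tc xc] /set_mem[/= Kt Kx] zmax] :=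
  compact_EVT_max (ex_intro _ (t, x) Ktx) cK cz.
apply: le_trans (zmax (t, x) (mem_set Ktx)) _.
rewrite leNgt; apply/negP => zc.
have htc : t0 <= tc <= t1 by move: Kt; rewrite in_itv.
have t0tc : t0 < tc.
  rewrite lt_neqAle; case/andP: (htc) => -> _; rewrite andbT; apply/eqP => E.
  move: zc; rewrite /z/= -E subrr mulr0 addr0 subr_gt0 ltNge.
  by rewrite (le_trans (v0 xc))// mulr_ge0 ?sqr_ge0// ltW.
have htc' : t0 < tc <= t1 by rewrite t0tc; case/andP: htc.
(* The maximum over the box is a maximum over the whole line, since outside the box [z] is
   nonpositive while [z (tc, xc)] is positive. *)
have zmaxx y : z (tc, y) <= z (tc, xc).
  have [yL|Ly] := leP `|y| L.
    by apply: zmax; apply/mem_set; split => //=; rewrite in_itv/= -ler_norml.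
  by apply: le_trans (outL _ _ htc Ly) _; exact: ltW.
(* The contradiction: the maximum forces [vxx <= 2 * e] and [vt >= 2 * e] at [(tc, xc)], whereas the
   heat equation makes [vt] half of [vxx], hence at most [e]. *)
have hxx : vxx tc xc - e * 2 <= 0.
  have dsq (y : R) : is_derive y 1 (fun y : R => - e * (y ^+ 2)) (- e * (2 * y)).
    apply: is_derive_eq (is_deriveZ (- e) (is_deriveX 2 (is_derive_id y 1))) _.
    by rewrite /GRing.scale/= expr1 mulr1.
  apply: (@second_derivative_max (fun y => v tc y + - e * y ^+ 2)
    (fun y => vx tc y + (- e * 2) * y) xc).
  - move=> y; rewrite -mulrA; exact: (is_deriveD (dx tc y htc') (dsq y)).
  - rewrite -mulNr; apply: (is_deriveD (dxx tc xc htc')).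
    exact: is_derive_mull.
  - by move=> y; have := zmaxx y; rewrite /z/=; lra.
have ht' : 0 <= vt tc xc - e * 2.
  apply: (@derive_within_left_max _ J (fun u => v u xc + (- e * 2) * u) t0 tc) => //.
  - by apply: subset_trans sJ => u /=; rewrite !in_itv/=; case/andP: htc' => ? ?; lra.
  - move=> u hu; have : K (u, xc) by split => //=; rewrite in_itv/=; lra.
    by move=> /mem_set/zmax; rewrite /z/=; lra.
  - rewrite -mulNr; apply: derive_withinD; first exact: dt.
    apply: derive_within_derive.
    exact: is_derive_mull.
have := heat _ xc htc'; lra.
Qed.

End MaximumPrinciple.

(** * Change of variables for C^{1,2} functions *)

Section Transform.
Context {R : realType}.

Lemma within_cvg (T S : topologicalType) (A : set T) (f : T -> S) (p : T)
    (I : Type) (F : set_system I) {FF : Filter F} (u : I -> T) :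
  {within A, continuous f} -> A p -> (\forall i \near F, A (u i)) ->
  u i @[i --> F] --> p -> f (u i) @[i --> F] --> f p.
Proof.
move=> /subspace_continuousP cf Ap Au up.
apply: (cvg_comp u f _ (cf p Ap)) => P; rewrite /within/= => nP.
have := up _ nP; rewrite /nbhs/= => h.
by apply: filterS2 Au h => i Ai; apply.
Qed.

Definition jcont (D : set R) (v : R -> R -> R) : Prop :=
  {within D `*` setT, continuous (fun q : R * R => v q.1 q.2)}.

Definition real_C12 (D : set R) (v vt va vaa : R -> R -> R) : Prop :=
  [/\ forall t a, D t -> derive_within D (v ^~ a) t (vt t a),
      forall t a : R, D t -> is_derive a 1 (v t) (va t a),
      forall t a : R, D t -> is_derive a 1 (va t) (vaa t a) &
      [/\ jcont D v, jcont D vt, jcont D va & jcont D vaa]].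

Lemma jcont_cvg (D : set R) (v : R -> R -> R) (t a : R) (I : Type) (F : set_system I) {FF : Filter F}
    (u x : I -> R) : jcont D v -> D t -> (\forall i \near F, D (u i)) ->
  u i @[i --> F] --> t -> x i @[i --> F] --> a ->
  v (u i) (x i) @[i --> F] --> v t a.
Proof.
move=> cv Dt Du cu cx.
apply: (@within_cvg _ _ _ (fun q : R * R => v q.1 q.2) (t, a) _ _ _ (fun i => (u i, x i)) cv) => //.
  by apply: filterS Du => i.
exact: (cvg_pair cu cx).
Qed.

Lemma jcont_seq (D : set R) (v : R -> R -> R) :
  (forall (t a : R) (u x : nat -> R), D t -> (forall n, D (u n)) ->
    u n @[n --> \oo] --> t -> x n @[n --> \oo] --> a ->
    v (u n) (x n) @[n --> \oo] --> v t a) -> jcont D v.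
Proof.
move=> H; apply: within_continuous_seq => -[t a] u [/= Dt _] Du cu cx.
by apply: H => // n; have [] := Du n.
Qed.

Lemma MVT_between (g dg : R -> R) (x y : R) : (forall z : R, is_derive z 1 g (dg z)) ->
  exists2 c, `|c - x| <= `|y - x| & g y - g x = dg c * (y - x).
Proof.
move=> dg'.
have cg a b : {within `[a, b], continuous g}.
  by apply: derivable_within_continuous => z _; have [] := dg' z.
have dgin (a b z : R) : z \in `]a, b[ -> is_derive z 1 g (dg z) by move=> _; exact: dg'.
have [xy|yx|->] := ltgtP x y; last by exists y => //; rewrite !subrr mulr0.
- have [c /[!in_itv]/= /andP[c0 c1] E] := MVT xy (@dgin x y) (@cg x y).
  by exists c => //; rewrite !gtr0_norm; lra.
- have [c /[!in_itv]/= /andP[c0 c1] E] := MVT yx (@dgin y x) (@cg y x).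
  exists c; first by rewrite !ltr0_norm; lra.
  by rewrite -opprB E; ring.
Qed.

(** Joint differentiability is not given, only partial derivatives, one-sided in time. The increment
    is therefore split: the space part, taken at the moving time [s - u], is handled by the mean
    value theorem and joint continuity of [va]; the time part is taken at the fixed point [x]. *)
Lemma derive_within_chain (E D : set R) (s : R) (v vt va vaa : R -> R -> R) (b : R -> R) (a t db : R) :
  (forall u, D u -> E (s - u)) -> real_C12 E v vt va vaa ->
  D t -> derive_within D b t db ->
  derive_within D (fun u => v (s - u) (a + b u)) t
    (va (s - t) (a + b t) * db - vt (s - t) (a + b t)).
Proof.
move=> DE [Ht Ha _ [_ _ cva _]] Dt dbt; set x := a + b t.
(* The intermediate points are chosen as a function of [u], with dummy value 0 outside [D]; the
   bound on [|c - x|] makes them converge to [x]. *)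
have /choice[xi Hxi] : forall u, exists c, D u ->
    `|c - x| <= `|b u - b t| /\
    v (s - u) (a + b u) - v (s - u) x = va (s - u) c * (b u - b t).
  move=> u; have [Du|nDu] := pselect (D u); last by exists 0.
  have [c c1 c2] := MVT_between x (a + b u) (fun z => Ha _ z (DE _ Du)).
  have E1 : a + b u - x = b u - b t by rewrite /x; ring.
  by exists c => _; rewrite E1 in c1 c2.
have cid : u @[u --> within D t^'] --> t by exact: cvg_within_dnbhs_id.
have cb : b u - b t @[u --> within D t^'] --> (0 : R).
  by rewrite -(subrr (b t)); apply: cvgB; [exact: derive_within_cvg dbt|exact: cvg_cst].
have cxi : xi u @[u --> within D t^'] --> x.
  apply/subr_cvg0; apply: norm_cvg0.
  apply: (@squeeze_cvgr _ _ _ _ (cst 0) (fun u => `|b u - b t|)).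
  - apply: filterS (near_within_mem D t) => u Du.
    by rewrite normr_ge0/=; have [] := Hxi u Du.
  - exact: cvg_cst.
  - by rewrite -(@normr0 _ R); exact: cvg_norm.
have c1 : va (s - u) (xi u) @[u --> within D t^'] --> va (s - t) x.
  apply: (@jcont_cvg E) => //; first exact: DE.
    by apply: filterS (near_within_mem D t) => u; exact: DE.
  by apply: cvgB => //; exact: cvg_cst.
have c2 : derive_within D (fun u => v (s - u) x) t (- vt (s - t) x).
  apply: (@derive_within_sub _ [set u | E (s - u)]).
    by exists 1 => // u _; exact: DE.
  by apply: (@derive_within_reflect _ E (v ^~ x) s t); apply: Ht; exact: DE.
have c : va (s - u) (xi u) * ((b u - b t) / (u - t)) +
    (v (s - u) x - v (s - t) x) / (u - t) @[u --> within D t^'] -->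
    va (s - t) x * db - vt (s - t) x.
  by apply: cvgD => //; apply: cvgM.
apply: cvg_trans c; apply: near_eq_cvg.
apply: filterS (near_within_mem D t) => u Du.
have [_ h] := Hxi u Du.
by rewrite mulrA -h -mulrDl; congr (_ / _); rewrite /x; ring.
Qed.

Lemma real_C12_transform (E D : set R) (s : R) (v vt va vaa : R -> R -> R) (b b' c c' d d' : R -> R) :
  (forall u, D u -> E (s - u)) -> real_C12 E v vt va vaa ->
  (forall t, D t -> derive_within D b t (b' t)) ->
  (forall t, D t -> derive_within D c t (c' t)) ->
  (forall t, D t -> derive_within D d t (d' t)) ->
  {within D, continuous b'} -> {within D, continuous c'} -> {within D, continuous d'} ->
  real_C12 D
    (fun t a => expR (c t + a * d t) * v (s - t) (a + b t))
    (fun t a => expR (c t + a * d t) * ((c' t + a * d' t) * v (s - t) (a + b t) +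
       (va (s - t) (a + b t) * b' t - vt (s - t) (a + b t))))
    (fun t a => expR (c t + a * d t) * (d t * v (s - t) (a + b t) + va (s - t) (a + b t)))
    (fun t a => expR (c t + a * d t) * ((d t) ^+ 2 * v (s - t) (a + b t) +
       2 * d t * va (s - t) (a + b t) + vaa (s - t) (a + b t))).
Proof.
move=> DE C12 hb hc hd cb' cc' cd'; have [Ht Ha Haa [cv cvt cva cvaa]] := C12.
have cb := derive_within_continuous hb.
have cc := derive_within_continuous hc.
have cd := derive_within_continuous hd.
have dexp (t a : R) : is_derive a 1 (fun a => expR (c t + a * d t))
    (d t * expR (c t + a * d t)).
  rewrite [X in is_derive _ _ _ X]mulrC.
  have h : is_derive a 1 (fun a => c t + a * d t) (d t).
    rewrite (_ : (fun a => _) = fun a => c t + d t * a); last first.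
      by apply/funext => z; rewrite (mulrC z).
    apply: is_derive_eq (is_deriveD (is_derive_cst (c t) a 1) (is_derive_mull (d t) a)) _.
    exact: add0r.
  exact: (is_derive1_comp (is_derive_expR _) h).
have dshift (g : R -> R) (z l k : R) : is_derive (z + k) 1 g l ->
    is_derive z 1 (fun a => g (a + k)) l.
  move=> dg.
  have h : is_derive z 1 (fun a => a + k) 1.
    apply: is_derive_eq (is_deriveD (is_derive_id z 1) (is_derive_cst k z 1)) _.
    exact: addr0.
  rewrite -[X in is_derive _ _ _ X]mulr1.
  exact: (@is_derive1_comp _ g (fun a => a + k) z l 1 dg h).
have dv (t a : R) : D t ->
    is_derive a 1 (fun a => v (s - t) (a + b t)) (va (s - t) (a + b t)).
  by move=> Dt; apply: dshift; apply: Ha; exact: DE.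
have dva (t a : R) : D t ->
    is_derive a 1 (fun a => va (s - t) (a + b t)) (vaa (s - t) (a + b t)).
  by move=> Dt; apply: dshift; apply: Haa; exact: DE.
split.
- move=> t a Dt.
  have dE : derive_within D (fun u => expR (c u + a * d u)) t
      (expR (c t + a * d t) * (c' t + a * d' t)).
    have dad : derive_within D (fun u => a * d u) t (a * d' t).
      have := derive_withinM (derive_within_derive D (is_derive_cst a t 1)) (hd t Dt).
      by rewrite mul0r add0r.
    exact: (@derive_within_comp _ D (fun u => c u + a * d u) expR _ _ _
      (derive_withinD (hc t Dt) dad) (is_derive_expR _)).
  have := derive_withinM dE (@derive_within_chain E D s v vt va vaa b a t (b' t) DE C12 Dt (hb t Dt)).
  by congr derive_within; ring.
- move=> t a Dt.
  apply: is_derive_eq (is_deriveM (dexp t a) (dv t a Dt)) _.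
  by rewrite /GRing.scale/=; ring.
- move=> t a Dt.
  apply: is_derive_eq (is_deriveM (dexp t a) (is_deriveD (is_deriveZ (d t) (dv t a Dt)) (dva t a Dt))) _.
  rewrite /GRing.scale/=.
  have -> : (d t \*: (fun a : R => v (s - t) (a + b t)) +
    (fun a : R => va (s - t) (a + b t))) a =
    d t * v (s - t) (a + b t) + va (s - t) (a + b t) by [].
  ring.
have seq1 (g : R -> R) : {within D, continuous g} -> forall (t : R) (u : nat -> R), D t ->
    (forall n, D (u n)) -> u n @[n --> \oo] --> t -> g (u n) @[n --> \oo] --> g t.
  by move=> cg t u Dt Du; apply: within_cvg => //; exact: nearW.
have seqE (t a : R) (u x : nat -> R) : D t -> (forall n, D (u n)) ->
    u n @[n --> \oo] --> t -> x n @[n --> \oo] --> a ->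
    expR (c (u n) + x n * d (u n)) @[n --> \oo] --> expR (c t + a * d t).
  move=> Dt Du cu cx; apply: continuous_cvg; first exact: continuous_expR.
  by apply: cvgD; [exact: seq1|apply: cvgM => //; exact: seq1].
have seqv (w : R -> R -> R) : jcont E w -> forall (t a : R) (u x : nat -> R), D t -> (forall n, D (u n)) ->
    u n @[n --> \oo] --> t -> x n @[n --> \oo] --> a ->
    w (s - u n) (x n + b (u n)) @[n --> \oo] --> w (s - t) (a + b t).
  move=> cw t a u x Dt Du cu cx; apply: (jcont_cvg cw).
  - exact: DE.
  - by apply: nearW => n; exact: DE.
  - by apply: cvgB => //; exact: cvg_cst.
  - by apply: cvgD => //; exact: seq1.
split; apply: jcont_seq => t a u x Dt Du cu cx; apply: cvgM; try exact: seqE.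
- exact: (seqv v).
- apply: cvgD.
    apply: cvgM; last exact: (seqv v).
    by apply: cvgD; [exact: seq1|apply: cvgM => //; exact: seq1].
  apply: cvgB; last exact: (seqv vt).
  by apply: cvgM; [exact: (seqv va)|exact: seq1].
- apply: cvgD; last exact: (seqv va).
  by apply: cvgM; [exact: seq1|exact: (seqv v)].
- have cdt : d (u n) @[n --> \oo] --> d t by exact: seq1.
  apply: cvgD; last exact: (seqv vaa).
  apply: cvgD; first by apply: cvgM; [exact: cvgM|exact: (seqv v)].
  apply: cvgM; last exact: (seqv va).
  by apply: cvgM => //; exact: cvg_cst.
Qed.

End Transform.

(** * Tail integrals *)

Section TailIntegral.
Context {R : realType}.
Local Notation mu := (@lebesgue_measure R).

Lemma derive_within_eq_near (J : set R) (g h : R -> R) (t l e : R) : 0 < e -> J t ->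
  (forall u, J u -> `|t - u| < e -> g u = h u) ->
  derive_within J g t l -> derive_within J h t l.
Proof.
move=> e0 Jt gh dg; apply: cvg_trans dg; apply: near_eq_cvg.
apply/nbhs_ballP; exists e => //= u bu _ Ju.
by rewrite !gh// subrr normr0.
Qed.

(* Common to both admissible shapes of the time domain [J]. *)
Definition upper_local (J : set R) : Prop := forall t, J t -> exists eps e,
  [/\ 0 < e, eps <= t, `[eps, +oo[ `<=` J & forall u, J u -> `|t - u| < e -> eps <= u].

Lemma upper_local_itv (J : set R) :
  J = `[0, +oo[%classic \/ J = `]0, +oo[%classic -> upper_local J.
Proof.
case=> -> t /=; rewrite in_itv/= andbT => t0.
- exists 0, 1; split => // u /=; by rewrite in_itv/= andbT.
- exists (t / 2), (t / 2); split; [lra|lra| |].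
    by move=> u /=; rewrite !in_itv/= !andbT; lra.
  by move=> u /=; rewrite in_itv/= andbT => u0; rewrite ltr_norml; lra.
Qed.

(** Since [g] is controlled only on [J], whose left end may be [t] itself, it is first extended
    continuously to the line; the two-sided fundamental theorem then applies, and near [t] within
    [J] nothing has changed. *)
Lemma derive_within_tail_integral (J : set R) (g : R -> R) (s t : R) :
  upper_local J -> {within J, continuous g} -> J t -> t < s ->
  derive_within (J `&` [set u | u < s])
    (fun u => \int[mu]_(x in `[u, s]) g x) t (- g t).
Proof.
move=> uJ cg Jt ts; have [eps [e [e0 et sJ Hu]]] := uJ t Jt.
have inJ z : eps <= z -> J z by move=> h; apply: sJ; rewrite /= in_itv/= h.
(* The extension is constant to the left of [eps]. *)
pose h z := g (Num.max z eps).
have ch : continuous h.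
  move=> z; apply: (@within_cvg _ _ J g (Num.max z eps) _ (nbhs z) _ (fun y => Num.max y eps)) => //.
  - by apply: inJ; rewrite le_max lexx orbT.
  - by apply: nearW => y; apply: inJ; rewrite le_max lexx orbT.
  - rewrite (_ : (fun y => _) = (fun y => (y + eps + `|y - eps|) / 2)); last first.
      by apply/funext => y; exact: maxr_absE.
    rewrite maxr_absE; apply: cvgM; last exact: cvg_cst.
    apply: cvgD; first by apply: cvgD; [exact: cvg_id|exact: cvg_cst].
    by apply: cvg_norm; apply: cvgB; [exact: cvg_id|exact: cvg_cst].
(* The base point lies strictly below [eps], so that even [t = eps] is interior to the interval of
   integration. *)
pose F x := \int[mu]_(z in `[eps - 1, x]) h z.
have ih a b : mu.-integrable `[a, b] (EFin \o h).
  apply: continuous_compact_integrable; first exact: segment_compact.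
  exact: continuous_subspaceT.
have dF x : eps - 1 < x -> is_derive x 1 F (h x).
  move=> ex.
  have xx : x < x + 1 by lra.
  have [dFx FE] := continuous_FTC1_closed xx (ih _ _) ex (ch x).
  by apply: DeriveDef; [exact: dFx|rewrite -derive1E; exact: FE].
have FE u : eps <= u -> u < s -> \int[mu]_(x in `[u, s]) g x = F s - F u.
  move=> eu us.
  have ihu : mu.-integrable `]u, s] (EFin \o h).
    by apply: (integrableS _ _ _ (ih u s)) => //; exact: subset_itv_oc_cc.
  rewrite /F (@Rintegral_itvB _ h (BLeft (eps - 1)) (BRight s) u (ih _ _)) ?bnd_simp;
    [|lra|exact: ltW].
  rewrite Rintegral_itv_obnd_cbnd//; apply: eq_Rintegral => x /[!inE]/=.
  rewrite in_itv/= => /andP[ux _]; rewrite /h.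
  by rewrite max_l//; lra.
apply: (@derive_within_eq_near _ (fun u => F s + - F u) _ t (- g t) e) => //.
  by move=> u [Ju us] tu; rewrite FE//; exact: Hu.
have -> : - g t = 0 + - h t by rewrite add0r /h max_l.
have dFt : is_derive t 1 F (h t) by apply: dF; lra.
exact: (derive_withinD (derive_within_derive _ (is_derive_cst (F s) t 1))
  (derive_within_derive _ (is_deriveN dFt))).
Qed.

End TailIntegral.

(** * The real-valued equations *)

Section RealEquations.
Context {R : realType}.
Local Notation mu := (@lebesgue_measure R).

Definition real_pde (D : set R) (f2 : R -> R) (w : R -> R -> R) : Prop :=
  exists wt wa waa : R -> R -> R, real_C12 D w wt wa waa /\
    forall t a, D t -> - wt t a + f2 t * a * w t a = 2^-1 * waa t a.

Definition real_heat (T : set R) (om : R -> R -> R) : Prop :=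
  exists omt omx omxx : R -> R -> R, real_C12 T om omt omx omxx /\
    forall tau x, T tau -> omt tau x = 2^-1 * omxx tau x.

Lemma jcont_ext (D : set R) (v w : R -> R -> R) :
  (forall t a, D t -> v t a = w t a) -> jcont D v -> jcont D w.
Proof.
move=> vw cv; apply: jcont_seq => t a u x Dt Du cu cx.
rewrite -vw// (_ : (fun n => w (u n) (x n)) = (fun n => v (u n) (x n))).
  by apply: (jcont_cvg cv) => //; exact: nearW.
by apply/funext => n; rewrite vw.
Qed.

Lemma real_C12_ext (D : set R) (v w vt va vaa : R -> R -> R) :
  (forall t a, D t -> v t a = w t a) -> real_C12 D v vt va vaa -> real_C12 D w vt va vaa.
Proof.
move=> vw [Ht Ha Haa [cv cvt cva cvaa]]; split => //.
- move=> t a Dt; apply: (@derive_within_eq_near _ D (v ^~ a) _ _ _ 1) => //.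
    by move=> u Du _; exact: vw.
  exact: Ht.
- by move=> t a Dt; rewrite -(_ : v t = w t); [exact: Ha|apply/funext => z; exact: vw].
- by split => //; exact: jcont_ext cv.
Qed.

Lemma real_pde_ext (D : set R) (f2 : R -> R) (v w : R -> R -> R) :
  (forall t a, D t -> v t a = w t a) -> real_pde D f2 v -> real_pde D f2 w.
Proof.
move=> vw [vt [va [vaa [C E]]]]; exists vt, va, vaa; split; first exact: real_C12_ext C.
by move=> t a Dt; rewrite -vw//; exact: E.
Qed.

Lemma is_derive_lin (k l : R) (g h : R -> R) (x dg dh : R) :
  is_derive x 1 g dg -> is_derive x 1 h dh ->
  is_derive x 1 (fun y => k * g y + l * h y) (k * dg + l * dh).
Proof. by move=> hg hh; exact: (is_deriveD (is_deriveZ k hg) (is_deriveZ l hh)). Qed.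

Lemma derive_within_lin (J : set R) (k l : R) (g h : R -> R) (x dg dh : R) :
  derive_within J g x dg -> derive_within J h x dh ->
  derive_within J (fun y => k * g y + l * h y) x (k * dg + l * dh).
Proof.
move=> hg hh; apply: derive_withinD.
  have := derive_withinM (derive_within_derive J (is_derive_cst k x 1)) hg.
  by rewrite mul0r add0r.
have := derive_withinM (derive_within_derive J (is_derive_cst l x 1)) hh.
by rewrite mul0r add0r.
Qed.

Lemma jcont_lin (D : set R) (k l : R) (v w : R -> R -> R) :
  jcont D v -> jcont D w -> jcont D (fun t a => k * v t a + l * w t a).
Proof.
move=> cv cw; apply: jcont_seq => t a u x Dt Du cu cx.
have Du' : \forall n \near \oo, D (u n) by exact: nearW.
by apply: cvgD; (apply: cvgM; first exact: cvg_cst);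
  [exact: (jcont_cvg cv)|exact: (jcont_cvg cw)].
Qed.

Lemma real_heat_lin (T : set R) (k l : R) (v w : R -> R -> R) :
  real_heat T v -> real_heat T w -> real_heat T (fun t a => k * v t a + l * w t a).
Proof.
move=> [vt [vx [vxx [[v1 v2 v3 [v4 v5 v6 v7]] vE]]]].
move=> [wt [wx [wxx [[w1 w2 w3 [w4 w5 w6 w7]] wE]]]].
exists (fun t a => k * vt t a + l * wt t a), (fun t a => k * vx t a + l * wx t a),
  (fun t a => k * vxx t a + l * wxx t a); split; last first.
  by move=> t a Tt; rewrite vE// wE//; ring.
split; last by split; exact: jcont_lin.
- by move=> t a Tt; apply: derive_within_lin; [exact: v1|exact: w1].
- by move=> t a Tt; apply: is_derive_lin; [exact: v2|exact: w2].
- by move=> t a Tt; apply: is_derive_lin; [exact: v3|exact: w3].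
Qed.

(** The strict gap absorbs the factors [y] and [y ^+ 2] produced by differentiation. It may depend
    on [tau], and each multiplication uses up half of it, so the condition is preserved. *)
Definition heat_admissible (T : set R) (p : R -> R) : Prop :=
  forall tau, T tau -> exists2 tau0, tau0 < tau & gauss_integrable p tau0.

Lemma heat_admissible_id T p :
  heat_admissible T p -> heat_admissible T (fun y => y * p y).
Proof.
move=> H tau /H[tau0 h ip]; exists ((tau0 + tau) / 2); first by lra.
by apply: gauss_integrable_id ip; lra.
Qed.

Lemma heat_admissible_sqr T p :
  heat_admissible T p -> heat_admissible T (fun y => y ^+ 2 * p y).
Proof.
move=> H tau /H[tau0 h ip]; exists ((tau0 + tau) / 2); first by lra.
by apply: gauss_integrable_sqr ip; lra.
Qed.

Lemma heat_admissible_gauss T p tau :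
  heat_admissible T p -> T tau -> gauss_integrable p tau.
Proof. by move=> H /H[tau0 h]; apply: gauss_integrable_le; exact: ltW. Qed.

Lemma jcont_fourier_heat (T : set R) (p : R -> R) (b : R) :
  heat_admissible T p -> jcont T (fun tau x => fourier_heat p tau x b).
Proof.
move=> H; apply: jcont_seq => t a u x Tt Tu cu cx.
have [tau0 h ip] := H t Tt.
apply: (@jcont_cvg _ [set tau | tau0 <= tau] (fun tau x => fourier_heat p tau x b)) => //=.
- exact: fourier_heat_continuous.
- exact: ltW.
- by apply: filterS (cvgr_gt _ cu _ h) => n; exact: ltW.
Qed.

Lemma real_heat_fourier (T : set R) (p : R -> R) (b : R) :
  heat_admissible T p -> real_heat T (fun tau x => fourier_heat p tau x b).
Proof.
move=> H; have H1 := heat_admissible_id H; have H2 := heat_admissible_id H1.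
have H3 := heat_admissible_sqr H.
exists (fun tau x => - (2^-1 * fourier_heat (fun y => y ^+ 2 * p y) tau x b)),
  (fun tau x => fourier_heat (fun y => y * p y) tau x (b + pi / 2)),
  (fun tau x => fourier_heat (fun y => y * (y * p y)) tau x (b + pi / 2 + pi / 2)).
split; last first.
  move=> tau x Ttau; rewrite -mulrN; congr (_ * _).
  have ip := heat_admissible_gauss H3 Ttau.
  rewrite -mulN1r -RintegralZl//; last exact: integrable_heat_kernel.
  apply: eq_Rintegral => y _.
  have -> : heat_kernel tau x (b + pi / 2 + pi / 2) y = - heat_kernel tau x b y.
    rewrite /heat_kernel (_ : y * x + _ = y * x + b + pi); last by field.
    by rewrite cosDpi mulrN.
  by ring.
split.
- move=> tau x Ttau; apply: derive_within_derive.
  have [t1 h1 i1] := H _ Ttau; have [t2 h2 i2] := H3 _ Ttau.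
  (* One earlier time has to serve both [p] and [y ^+ 2 * p y]; the later of the two candidates
     does. *)
  apply: (@fourier_heat_dtau _ _ (Num.max t1 t2)); first by rewrite gt_max h1.
    by apply: gauss_integrable_le i1; rewrite le_max lexx.
  by apply: gauss_integrable_le i2; rewrite le_max lexx orbT.
- by move=> tau x Ttau; apply: fourier_heat_dx; exact: heat_admissible_gauss Ttau.
- by move=> tau x Ttau; apply: fourier_heat_dx; exact: heat_admissible_gauss Ttau.
split; try exact: jcont_fourier_heat.
apply: (@jcont_ext _ (fun tau x => - 2^-1 * fourier_heat (fun y => y ^+ 2 * p y) tau x b +
    0 * fourier_heat p tau x b)).
  by move=> t a _; rewrite mul0r addr0 mulNr.
by apply: jcont_lin; exact: jcont_fourier_heat.
Qed.

(** * Passage between the equation and the heat equation *)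

Section TimeChange.
Variables (D : set R) (s : R) (f1 f2 A Q : R -> R).
Hypothesis df1 : forall t, D t -> derive_within D f1 t (f2 t).
Hypothesis dA : forall t, D t -> derive_within D A t (- f1 t).
Hypothesis dQ : forall t, D t -> derive_within D Q t (- (f1 t) ^+ 2).
Hypothesis cf2 : {within D, continuous f2}.
Let T := [set tau | D (s - tau)].

Let cf1 := derive_within_continuous df1.
Let cA := derive_within_continuous dA.

Let sK u : s - (s - u) = u. Proof. by rewrite opprB addrC subrK. Qed.

(** In [- w_t] the derivative of [a * f1] cancels the potential [f2 * a * w]; what remains, up to
    the exponential, is [f1 ^+ 2 / 2 * om] from [Q] and [f1 * omx] from [A], which are the
    lower-order terms of [w_aa / 2]. Only [omt] against [omxx / 2] is left. *)
Lemma real_pde_of_heat (om : R -> R -> R) : real_heat T om ->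
  real_pde D f2 (fun t a => expR (2^-1 * Q t + a * f1 t) * om (s - t) (a + A t)).
Proof.
move=> [omt [omx [omxx [C E]]]].
have DT u : D u -> T (s - u) by move=> Du; rewrite /T/= sK.
have dc t : D t -> derive_within D (fun t => 2^-1 * Q t) t (2^-1 * - (f1 t) ^+ 2).
  move=> Dt; have := derive_withinM (derive_within_derive D (is_derive_cst (2^-1 : R) t 1)) (dQ Dt).
  by rewrite mul0r add0r.
have cN : {within D, continuous (fun t => - f1 t)}.
  by apply: within_continuousP => t Dt; apply: cvgN; exact: derive_within_cvg (df1 Dt).
have cc : {within D, continuous (fun t => 2^-1 * - (f1 t) ^+ 2)}.
  apply: within_continuousP => t Dt; apply: cvgM; first exact: cvg_cst.
  apply: cvgN; rewrite /GRing.exp/=.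
  by apply: cvgM; exact: derive_within_cvg (df1 Dt).
have C' := @real_C12_transform _ T D s om omt omx omxx A (fun t => - f1 t)
  (fun t => 2^-1 * Q t) (fun t => 2^-1 * - (f1 t) ^+ 2) f1 f2 DT C dA dc df1 cN cc cf2.
exists (fun t a => expR (2^-1 * Q t + a * f1 t) *
    ((2^-1 * - (f1 t) ^+ 2 + a * f2 t) * om (s - t) (a + A t) +
     (omx (s - t) (a + A t) * (- f1 t) - omt (s - t) (a + A t)))),
  (fun t a => expR (2^-1 * Q t + a * f1 t) *
    (f1 t * om (s - t) (a + A t) + omx (s - t) (a + A t))),
  (fun t a => expR (2^-1 * Q t + a * f1 t) * ((f1 t) ^+ 2 * om (s - t) (a + A t) +
       2 * f1 t * omx (s - t) (a + A t) + omxx (s - t) (a + A t))).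
split; first exact: C'.
by move=> t a Dt; rewrite E//; [field|exact: DT].
Qed.

(** Solving the substitution for [om] at [t = s - tau], [a = x - A t] gives the exponent
    [- (Q t / 2 + (x - A t) * f1 t)], written here as an affine function of [x]. *)
Lemma real_heat_of_pde (w : R -> R -> R) : real_pde D f2 w ->
  real_heat T (fun tau x =>
    expR (- (2^-1 * Q (s - tau)) + A (s - tau) * f1 (s - tau) + x * (- f1 (s - tau))) *
    w (s - tau) (x + - A (s - tau))).
Proof.
move=> [wt [wa [waa [C E]]]].
have reflect_cont (g : R -> R) : {within D, continuous g} ->
    {within T, continuous (fun tau => g (s - tau))}.
  move=> cg; apply/subspace_continuousP => tau Ttau.
  apply: (@within_cvg _ _ D g (s - tau) _ _ _ (fun tau => s - tau)) => //.
    by apply: filterS (withinT T (nbhs_filter tau)).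
  apply: cvg_within_filter; apply: cvgB; [exact: cvg_cst|exact: cvg_id].
have dbT tau : T tau -> derive_within T (fun tau => - A (s - tau)) tau (- f1 (s - tau)).
  move=> Tt; have := @derive_within_comp _ T (fun tau => A (s - tau)) (fun z => - z) tau
    (- - f1 (s - tau)) (-1) (derive_within_reflect (dA Tt)).
  rewrite mulN1r opprK; apply.
have dd tau : T tau -> derive_within T (fun tau => - f1 (s - tau)) tau (f2 (s - tau)).
  move=> Tt; have := @derive_within_comp _ T (fun tau => f1 (s - tau)) (fun z => - z) tau
    (- f2 (s - tau)) (-1) (derive_within_reflect (df1 Tt)).
  rewrite mulN1r opprK; apply.
have dc tau : T tau -> derive_within T
    (fun tau => - (2^-1 * Q (s - tau)) + A (s - tau) * f1 (s - tau)) tau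
    (2^-1 * (f1 (s - tau)) ^+ 2 - A (s - tau) * f2 (s - tau)).
  move=> Tt.
  have h1 := derive_withinM (derive_within_derive T (is_derive_cst (- 2^-1 : R) tau 1))
    (derive_within_reflect (dQ Tt)).
  have h2 := derive_withinM (derive_within_reflect (dA Tt)) (derive_within_reflect (df1 Tt)).
  have := derive_withinD h1 h2.
  rewrite (_ : (fun u => _) = (fun u => - (2^-1 * Q (s - u)) + A (s - u) * f1 (s - u))); last first.
    by apply/funext => u /=; rewrite mulNr.
  by congr derive_within; rewrite /cst; field.
have cb : {within T, continuous (fun tau => - f1 (s - tau))}.
  exact: derive_within_continuous dd.
have cd := reflect_cont _ cf2.
have cc : {within T, continuous
    (fun tau => 2^-1 * (f1 (s - tau)) ^+ 2 - A (s - tau) * f2 (s - tau))}.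
  apply/subspace_continuousP => tau Tt.
  have /subspace_continuousP/(_ _ Tt) k1 := reflect_cont _ cf1.
  have /subspace_continuousP/(_ _ Tt) k2 := cd.
  have /subspace_continuousP/(_ _ Tt) k3 := reflect_cont _ cA.
  apply: cvgB; last exact: cvgM.
  by apply: cvgM; [exact: cvg_cst|exact: cvgM].
have TD u : T u -> D (s - u) by [].
have C' := real_C12_transform TD C dbT dc dd cb cc cd.
move: C'; set wt' := (X in real_C12 _ _ X _ _); set wa' := (X in real_C12 _ _ _ X _).
set waa' := (X in real_C12 _ _ _ _ X) => C'.
exists wt', wa', waa'; split => // tau x Tt; rewrite /wt' /waa'.
have := E _ (x + - A (s - tau)) Tt => /(canRL (addrK _)) /(canRL opprK) ->.
by field.
Qed.

End TimeChange.

End RealEquations.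

(** * Complex-valued functions *)

Section ComplexValued.
Context {R : realType}.
Local Notation mu := (@lebesgue_measure R).
Local Notation Re := (@complex.Re R).
Local Notation Im := (@complex.Im R).

Lemma Re_realM (k : R) (z : R[i]) : Re (k%:C * z) = k * Re z.
Proof. by case: z => a b /=; rewrite mul0r subr0. Qed.

Lemma Im_realM (k : R) (z : R[i]) : Im (k%:C * z) = k * Im z.
Proof. by case: z => a b /=; rewrite mul0r addr0. Qed.

Lemma ReM (z w : R[i]) : Re (z * w) = Re z * Re w - Im z * Im w.
Proof. by case: z w => [a b] [c d]. Qed.

Lemma ImM (z w : R[i]) : Im (z * w) = Re z * Im w + Im z * Re w.
Proof. by case: z w => [a b] [c d]. Qed.

Lemma complex_ext (z w : R[i]) : Re z = Re w -> Im z = Im w -> z = w.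
Proof. by case: z w => [a b] [c d] /= -> ->. Qed.

Lemma invr2_complex : (2^-1 : R[i]) = (2^-1 : R)%:C.
Proof. by rewrite -(rmorph_nat (real_complex R)) fmorphV. Qed.

Lemma class_C12P (D : set R) (v vt va vaa : R -> R -> R[i]) :
  class_C12 D v vt va vaa <->
  real_C12 D (fun t a => Re (v t a)) (fun t a => Re (vt t a))
    (fun t a => Re (va t a)) (fun t a => Re (vaa t a)) /\
  real_C12 D (fun t a => Im (v t a)) (fun t a => Im (vt t a))
    (fun t a => Im (va t a)) (fun t a => Im (vaa t a)).
Proof.
split.
  move=> [Ht Ha Haa [[c1 c1'] [c2 c2'] [c3 c3'] [c4 c4']]].
  by split; split=> // t a Dt; have [] := Ht t a Dt; have [] := Ha t a Dt;
    have [] := Haa t a Dt.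
move=> [[Ht Ha Haa [c1 c2 c3 c4]] [Ht' Ha' Haa' [c1' c2' c3' c4']]].
split; [| | |by split; split] => t a Dt.
- by split; [exact: Ht|exact: Ht'].
- by split; [exact: Ha|exact: Ha'].
- by split; [exact: Haa|exact: Haa'].
Qed.

Lemma heat_solutionP (T : set R) (om : R -> R -> R[i]) :
  heat_solution T om <-> real_heat T (fun t a => Re (om t a)) /\
                         real_heat T (fun t a => Im (om t a)).
Proof.
split.
  move=> [omt [omx [omxx [/class_C12P[C C'] E]]]]; split.
    exists (fun t a => Re (omt t a)), (fun t a => Re (omx t a)), (fun t a => Re (omxx t a)).
    by split => // t a Tt; rewrite E// invr2_complex Re_realM.
  exists (fun t a => Im (omt t a)), (fun t a => Im (omx t a)), (fun t a => Im (omxx t a)).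
  by split => // t a Tt; rewrite E// invr2_complex Im_realM.
move=> [[vt [vx [vxx [C E]]]] [wt [wx [wxx [C' E']]]]].
exists (fun t a => vt t a +i* wt t a), (fun t a => vx t a +i* wx t a),
  (fun t a => vxx t a +i* wxx t a); split; first by apply/class_C12P.
move=> t a Tt; rewrite invr2_complex; apply: complex_ext.
  by rewrite Re_realM/= E.
by rewrite Im_realM/= E'.
Qed.

Lemma pde_solutionP (D : set R) (f2 : R -> R) (w : R -> R -> R[i]) :
  pde_solution D f2 w <-> real_pde D f2 (fun t a => Re (w t a)) /\
                          real_pde D f2 (fun t a => Im (w t a)).
Proof.
have ReD (z z' : R[i]) : Re (- z + z') = - Re z + Re z' by case: z z' => [? ?] [? ?].
have ImD (z z' : R[i]) : Im (- z + z') = - Im z + Im z' by case: z z' => [? ?] [? ?].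
split.
  move=> [wt [wa [waa [/class_C12P[C C'] E]]]]; split.
    exists (fun t a => Re (wt t a)), (fun t a => Re (wa t a)), (fun t a => Re (waa t a)).
    split => // t a Tt; have := congr1 Re (E t a Tt).
    by rewrite ReD invr2_complex !Re_realM.
  exists (fun t a => Im (wt t a)), (fun t a => Im (wa t a)), (fun t a => Im (waa t a)).
  split => // t a Tt; have := congr1 Im (E t a Tt).
  by rewrite ImD invr2_complex !Im_realM.
move=> [[vt [vx [vxx [C E]]]] [wt [wx [wxx [C' E']]]]].
exists (fun t a => vt t a +i* wt t a), (fun t a => vx t a +i* wx t a),
  (fun t a => vxx t a +i* wxx t a); split; first by apply/class_C12P.
move=> t a Tt; rewrite invr2_complex; apply: complex_ext.
  by rewrite ReD !Re_realM/= E.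
by rewrite ImD !Im_realM/= E'.
Qed.

Lemma Re_heat_integrand (Pi : R -> R[i]) tau x y :
  Re (heat_integrand Pi tau x y) =
  Re (Pi y) * heat_kernel tau x 0 y + Im (Pi y) * heat_kernel tau x (pi / 2) y.
Proof.
rewrite /heat_integrand ReM /cexp Re_realM Im_realM /=.
by rewrite /heat_kernel addr0 cosDpihalf; ring.
Qed.

Lemma Im_heat_integrand (Pi : R -> R[i]) tau x y :
  Im (heat_integrand Pi tau x y) =
  Re (Pi y) * heat_kernel tau x (- (pi / 2)) y + Im (Pi y) * heat_kernel tau x 0 y.
Proof.
rewrite /heat_integrand ImM /cexp Re_realM Im_realM /=.
by rewrite /heat_kernel addr0 cosBpihalf; ring.
Qed.

Lemma cexpD (z w : R[i]) : cexp (z + w) = cexp z * cexp w.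
Proof.
case: z w => [a b] [c d]; rewrite /cexp/=.
apply: complex_ext.
  by rewrite Re_realM ReM !Re_realM !Im_realM/= expRD cosD; ring.
by rewrite Im_realM ImM !Re_realM !Im_realM/= expRD sinD; ring.
Qed.

(** Semigroup law on the frequency side. It holds for negative times too, where the backward
    evolution is just pointwise multiplication by a growing Gaussian. *)
Lemma heat_integrandD (Pi : R -> R[i]) t t' x x' :
  heat_integrand (heat_integrand Pi t x) t' x' = heat_integrand Pi (t + t') (x + x').
Proof.
apply/funext => y; rewrite /heat_integrand -mulrA -cexpD; congr (_ * cexp _).
by apply: complex_ext => /=; ring.
Qed.

Lemma heat_integrand00 (Pi : R -> R[i]) : heat_integrand Pi 0 0 = Pi.
Proof.
apply/funext => y; rewrite /heat_integrand !mulr0 oppr0 /cexp/= expR0 cos0 sin0.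
by apply: complex_ext; rewrite ?ReM ?ImM /=; ring.
Qed.

Lemma heat_integrandZ (k : R) (Pi : R -> R[i]) t x :
  heat_integrand (fun y => k%:C * Pi y) t x = fun y => k%:C * heat_integrand Pi t x y.
Proof. by apply/funext => y; rewrite /heat_integrand mulrA. Qed.

Lemma gauss_integrable0 (p : R -> R) :
  gauss_integrable p 0 <-> mu.-integrable setT (EFin \o p).
Proof.
rewrite /gauss_integrable (_ : (fun y => _) = p)//.
by apply/funext => y; rewrite mulr0 oppr0 expR0 mulr1.
Qed.

(** Integrability does not depend on [x]: the opposite phase, of modulus 1, removes it, after which
    the real and imaginary parts of [Pi] separate. *)
Lemma cintegrable_heatP (Pi : R -> R[i]) tau x :
  cintegrable (heat_integrand Pi tau x) <->
  gauss_integrable (Re \o Pi) tau /\ gauss_integrable (Im \o Pi) tau.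
Proof.
have lin (p q : R -> R) : mu.-integrable setT (EFin \o p) ->
    mu.-integrable setT (EFin \o q) ->
    mu.-integrable setT (EFin \o (fun y => p y + q y)).
  move=> ip iq; have := integrable_lin 1 1 measurableT ip iq.
  by under eq_fun do rewrite !mul1r.
split; last first.
  move=> [ip iq]; split; under eq_fun do rewrite ?Re_heat_integrand ?Im_heat_integrand.
    by apply: lin; apply: integrable_heat_kernel.
  by apply: lin; apply: integrable_heat_kernel.
move=> [/gauss_integrable0 ir /gauss_integrable0 ii].
have E := heat_integrandD Pi tau 0 x (- x).
rewrite addr0 subrr in E.
have e1 y : Re (Pi y) * expR (- (2^-1 * y ^+ 2 * tau)) = Re (heat_integrand Pi tau 0 y).
  rewrite Re_heat_integrand /heat_kernel mulr0 addr0 add0r cos0 cos_pihalf; ring.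
have e2 y : Im (Pi y) * expR (- (2^-1 * y ^+ 2 * tau)) = Im (heat_integrand Pi tau 0 y).
  rewrite Im_heat_integrand /heat_kernel mulr0 addr0 add0r cos0 cosN cos_pihalf; ring.
split; rewrite /gauss_integrable/=.
  under eq_fun do rewrite e1 -E Re_heat_integrand.
  by apply: lin; apply: integrable_heat_kernel.
under eq_fun do rewrite e2 -E Im_heat_integrand.
by apply: lin; apply: integrable_heat_kernel.
Qed.

Lemma Re_heat_integral (Pi : R -> R[i]) tau x :
  gauss_integrable (Re \o Pi) tau -> gauss_integrable (Im \o Pi) tau ->
  Re (heat_integral Pi tau x) = (2 * pi)^-1 * fourier_heat (Re \o Pi) tau x 0 +
    (2 * pi)^-1 * fourier_heat (Im \o Pi) tau x (pi / 2).
Proof.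
move=> ip iq; rewrite /heat_integral Re_realM/= -mulrDr; congr (_ * _).
under eq_Rintegral do rewrite Re_heat_integrand.
by rewrite RintegralD//; exact: integrable_heat_kernel.
Qed.

Lemma Im_heat_integral (Pi : R -> R[i]) tau x :
  gauss_integrable (Re \o Pi) tau -> gauss_integrable (Im \o Pi) tau ->
  Im (heat_integral Pi tau x) = (2 * pi)^-1 * fourier_heat (Re \o Pi) tau x (- (pi / 2)) +
    (2 * pi)^-1 * fourier_heat (Im \o Pi) tau x 0.
Proof.
move=> ip iq; rewrite /heat_integral Im_realM/= -mulrDr; congr (_ * _).
under eq_Rintegral do rewrite Im_heat_integrand.
by rewrite RintegralD//; exact: integrable_heat_kernel.
Qed.

Lemma real_heat_ext (T : set R) (v w : R -> R -> R) :
  (forall t a, T t -> v t a = w t a) -> real_heat T v -> real_heat T w.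
Proof.
move=> vw [vt [va [vaa [C E]]]]; exists vt, va, vaa; split => //.
exact: real_C12_ext C.
Qed.

Lemma heat_integral_solution (T : set R) (Pi : R -> R[i]) :
  heat_admissible T (Re \o Pi) -> heat_admissible T (Im \o Pi) ->
  heat_solution T (heat_integral Pi).
Proof.
move=> hp hq; apply/heat_solutionP; split.
  apply: (@real_heat_ext _ (fun t x => (2 * pi)^-1 * fourier_heat (Re \o Pi) t x 0 +
    (2 * pi)^-1 * fourier_heat (Im \o Pi) t x (pi / 2))).
    by move=> t a Tt; rewrite Re_heat_integral//; exact: heat_admissible_gauss Tt.
  by apply: real_heat_lin; exact: real_heat_fourier.
apply: (@real_heat_ext _ (fun t x => (2 * pi)^-1 * fourier_heat (Re \o Pi) t x (- (pi / 2)) +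
    (2 * pi)^-1 * fourier_heat (Im \o Pi) t x 0)).
  by move=> t a Tt; rewrite Im_heat_integral//; exact: heat_admissible_gauss Tt.
by apply: real_heat_lin; exact: real_heat_fourier.
Qed.

Lemma fourier_heat_phase (p : R -> R) tau x b : gauss_integrable p tau ->
  fourier_heat p tau x b = cos b * fourier_heat p tau x 0 +
    - sin b * fourier_heat p tau x (- (pi / 2)).
Proof.
move=> ip; rewrite -Rintegral_lin//; try exact: integrable_heat_kernel.
apply: eq_Rintegral => y _; rewrite /heat_kernel addr0 cosBpihalf cosD; ring.
Qed.

Lemma fourier_heat_cosN (p : R -> R) tau x :
  fourier_heat p tau (- x) 0 = fourier_heat p tau x 0.
Proof.
by apply: eq_Rintegral => y _; rewrite /heat_kernel !addr0 mulrN cosN.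
Qed.

Lemma fourier_heat_sinN (p : R -> R) tau x : gauss_integrable p tau ->
  fourier_heat p tau (- x) (- (pi / 2)) = - fourier_heat p tau x (- (pi / 2)).
Proof.
move=> ip; rewrite -[RHS]mulN1r -RintegralZl//; last exact: integrable_heat_kernel.
apply: eq_Rintegral => y _; rewrite /heat_kernel !cosBpihalf mulrN sinN; ring.
Qed.

Lemma fourier_heat_lin (k l : R) (p q : R -> R) tau x b :
  gauss_integrable p tau -> gauss_integrable q tau ->
  fourier_heat (fun y => k * p y + l * q y) tau x b =
  k * fourier_heat p tau x b + l * fourier_heat q tau x b.
Proof.
move=> ip iq; rewrite -Rintegral_lin//; try exact: integrable_heat_kernel.
by apply: eq_Rintegral => y _; ring.
Qed.

(** The hypotheses say that the Fourier transform of $p + iq$ vanishes. Cosine transforms are even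
    and sine transforms odd in [x], so comparing [x] with [- x] separates the four real
    transforms. *)
Lemma fourier_null_pair (p q : R -> R) :
  gauss_integrable p 0 -> gauss_integrable q 0 ->
  (forall x, fourier_heat p 0 x 0 + fourier_heat q 0 x (pi / 2) = 0) ->
  (forall x, fourier_heat p 0 x (- (pi / 2)) + fourier_heat q 0 x 0 = 0) ->
  fourier_null p /\ fourier_null q.
Proof.
move=> ip iq H1 H2.
have Q x : fourier_heat q 0 x (pi / 2) = - fourier_heat q 0 x (- (pi / 2)).
  by rewrite (fourier_heat_phase _ (pi / 2) iq) cos_pihalf sin_pihalf; ring.
have Z x : [/\ fourier_heat p 0 x 0 = 0, fourier_heat p 0 x (- (pi / 2)) = 0,
    fourier_heat q 0 x 0 = 0 & fourier_heat q 0 x (- (pi / 2)) = 0].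
  have := H1 x; have := H1 (- x); have := H2 x; have := H2 (- x).
  rewrite !Q !fourier_heat_cosN !fourier_heat_sinN// => h1 h2 h3 h4.
  by split; lra.
have N (r : R -> R) : gauss_integrable r 0 ->
    (forall x, fourier_heat r 0 x 0 = 0 /\ fourier_heat r 0 x (- (pi / 2)) = 0) ->
    fourier_null r.
  move=> ir Hr; split; first exact: ((gauss_integrable0 r).1 ir).
  move=> x b; have [r1 r2] := Hr x.
  transitivity (fourier_heat r 0 x b); last first.
    by rewrite fourier_heat_phase// r1 r2; ring.
  apply: eq_Rintegral => y _.
  by rewrite /heat_kernel mulr0 oppr0 expR0 mul1r (mulrC x).
by split; apply: N => // x; have [] := Z x.
Qed.

Lemma heat_integral_inj (V1 V2 : R -> R[i]) : cintegrable V1 -> cintegrable V2 ->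
  (forall x, heat_integral V1 0 x = heat_integral V2 0 x) ->
  {ae mu, forall y, V1 y = V2 y}.
Proof.
move=> [/gauss_integrable0 i1 /gauss_integrable0 j1].
move=> [/gauss_integrable0 i2 /gauss_integrable0 j2] H.
have k0 : (2 * pi)^-1 != 0 :> R by rewrite invr_eq0 mulf_neq0// gt_eqF// pi_gt0.
pose p y := 1 * Re (V1 y) + -1 * Re (V2 y).
pose q y := 1 * Im (V1 y) + -1 * Im (V2 y).
have gl (g h : R -> R) : gauss_integrable g 0 -> gauss_integrable h 0 ->
    gauss_integrable (fun y => 1 * g y + -1 * h y) 0.
  by move=> /gauss_integrable0 ig /gauss_integrable0 ih;
    apply/gauss_integrable0; exact: integrable_lin.
have [|||| np nq] := @fourier_null_pair p q.
- exact: gl.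
- exact: gl.
- move=> x; have := congr1 Re (H x).
  rewrite !Re_heat_integral// -!mulrDr => /(mulfI k0) E.
  by rewrite !fourier_heat_lin//; move: E; rewrite /comp; lra.
- move=> x; have := congr1 Im (H x).
  rewrite !Im_heat_integral// -!mulrDr => /(mulfI k0) E.
  by rewrite !fourier_heat_lin//; move: E; rewrite /comp; lra.
have := @filterS2 _ _ (ae_filter_ringOfSetsType mu) _ _ (fun y => V1 y = V2 y) _
  (fourier_null_ae0 np) (fourier_null_ae0 nq).
by apply => y; rewrite /p /q => h1 h2; apply: complex_ext; lra.
Qed.

End ComplexValued.

(** * Uniqueness of bounded heat solutions *)

Section Uniqueness.
Context {R : realType}.
Local Notation mu := (@lebesgue_measure R).
Local Notation Re := (@complex.Re R).
Local Notation Im := (@complex.Im R).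

Lemma jcont_sub (D D' : set R) (v : R -> R -> R) : D' `<=` D -> jcont D v -> jcont D' v.
Proof. by move=> h; apply: continuous_subspaceW => -[t a] [/h]. Qed.

Lemma real_heat_sub (T T' : set R) (v : R -> R -> R) :
  T' `<=` T -> real_heat T v -> real_heat T' v.
Proof.
move=> h [vt [vx [vxx [[c1 c2 c3 [c4 c5 c6 c7]] E]]]]; exists vt, vx, vxx.
split; last by move=> t a /h; exact: E.
split; last by split; exact: jcont_sub h _.
- move=> t a T't; apply: (@derive_within_sub _ T); last by apply: c1; exact: h.
  by exists 1 => // u _; exact: h.
- by move=> t a /h; exact: c2.
- by move=> t a /h; exact: c3.
Qed.

Lemma real_heat_le (t0 t1 M : R) (v1 v2 : R -> R -> R) :
  jcont `[t0, t1] v1 -> jcont `[t0, t1] v2 ->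
  real_heat `]t0, t1] v1 -> real_heat `]t0, t1] v2 ->
  (forall t x, t0 <= t <= t1 -> `|v1 t x| <= M) ->
  (forall t x, t0 <= t <= t1 -> `|v2 t x| <= M) ->
  (forall x, v1 t0 x = v2 t0 x) ->
  forall t x, t0 <= t <= t1 -> v1 t x <= v2 t x.
Proof.
move=> cv1 cv2 h1 h2 b1 b2 E t x ht.
have [dt [dx [dxx [[c1 c2 c3 _] heat]]]] := real_heat_lin 1 (-1) h1 h2.
have inI (u : R) : t0 < u <= t1 -> `]t0, t1]%classic u by rewrite /= in_itv.
have := @heat_max_principle _ t0 t1 (M + M) `]t0, t1]
  (fun t a => 1 * v1 t a + -1 * v2 t a) dt dx dxx (fun _ => id) (@jcont_lin _ _ 1 (-1) _ _ cv1 cv2)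
  (fun t x ht => c1 t x (inI _ ht)) (fun t x ht => c2 t x (inI _ ht))
  (fun t x ht => c3 t x (inI _ ht)) (fun t x ht => heat t x (inI _ ht)) _ _ t x ht.
rewrite mul1r mulN1r subr_le0; apply.
- move=> u y hu; have := b1 u y hu; have := b2 u y hu.
  by rewrite !ler_norml => /andP[? ?] /andP[? ?]; lra.
- by move=> y; rewrite E; lra.
Qed.

(** Continuity is asked on the closed interval but the equation only after [t0]: a Fourier integral
    whose weight is integrable at [t0], and perhaps at no earlier time, still qualifies. *)
Lemma real_heat_unique (t0 t1 M : R) (v1 v2 : R -> R -> R) :
  jcont `[t0, t1] v1 -> jcont `[t0, t1] v2 ->
  real_heat `]t0, t1] v1 -> real_heat `]t0, t1] v2 ->
  (forall t x, t0 <= t <= t1 -> `|v1 t x| <= M) ->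
  (forall t x, t0 <= t <= t1 -> `|v2 t x| <= M) ->
  (forall x, v1 t0 x = v2 t0 x) ->
  forall t x, t0 <= t <= t1 -> v1 t x = v2 t x.
Proof.
move=> cv1 cv2 h1 h2 b1 b2 E t x ht; apply/eqP; rewrite eq_le.
by rewrite (real_heat_le cv1 cv2 h1 h2 b1 b2)//= (real_heat_le cv2 cv1 h2 h1 b2 b1).
Qed.

Lemma fourier_heat_bound (p : R -> R) (t0 t x b : R) : gauss_integrable p t0 -> t0 <= t ->
  `|fourier_heat p t x b| <= \int[mu]_y (`|p y| * expR (- (2^-1 * y ^+ 2 * t0))).
Proof.
move=> ip h.
have ik := integrable_heat_kernel x b (gauss_integrable_le h ip).
apply: le_trans (le_normr_Rintegral _ ik) _ => //.
apply: le_Rintegral => //; first exact: (integrable_norm ik).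
  exact: integrable_dominating.
by move=> y _; rewrite normrM ler_wpM2l//; exact: heat_kernel_le.
Qed.

Lemma heat_integral_unique (T : set R) (t0 t1 M : R) (om : R -> R -> R[i])
    (Pi : R -> R[i]) :
  `[t0, t1] `<=` T -> heat_solution T om ->
  (forall t x, t0 <= t <= t1 -> `|Re (om t x)| <= M /\ `|Im (om t x)| <= M) ->
  gauss_integrable (Re \o Pi) t0 -> gauss_integrable (Im \o Pi) t0 ->
  (forall x, om t0 x = heat_integral Pi t0 x) ->
  forall t x, t0 <= t <= t1 -> om t x = heat_integral Pi t x.
Proof.
move=> sT /heat_solutionP[hr hi] bM ip iq E t x ht.
have sT' : `]t0, t1] `<=` T by apply: subset_trans sT; exact: subset_itv_oc_cc.
have jc v : real_heat T v -> jcont `[t0, t1] v.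
  by move=> [? [? [? [[_ _ _ [c _ _ _]] _]]]]; exact: jcont_sub sT c.
have ip' u : t0 <= u -> gauss_integrable (Re \o Pi) u.
  by move=> h; exact: gauss_integrable_le ip.
have iq' u : t0 <= u -> gauss_integrable (Im \o Pi) u.
  by move=> h; exact: gauss_integrable_le iq.
have adm (p : R -> R) : gauss_integrable p t0 -> heat_admissible `]t0, t1] p.
  by move=> ig u /=; rewrite in_itv/= => /andP[h _]; exists t0.
have jf (p : R -> R) b : gauss_integrable p t0 ->
    jcont `[t0, t1] (fun u x => fourier_heat p u x b).
  move=> ig; apply: (@jcont_sub [set u | t0 <= u]).
    by move=> u /=; rewrite in_itv/= => /andP[].
  exact: fourier_heat_continuous.
pose B (p : R -> R) := \int[mu]_y (`|p y| * expR (- (2^-1 * y ^+ 2 * t0))).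
have bf (p : R -> R) u y b : gauss_integrable p t0 -> t0 <= u ->
    `|fourier_heat p u y b| <= B p by exact: fourier_heat_bound.
pose k : R := (2 * pi)^-1.
have k0 : 0 <= k by rewrite invr_ge0 mulr_ge0// pi_ge0.
pose C := Num.max M (k * B (Re \o Pi) + k * B (Im \o Pi)).
have MC : M <= C by rewrite /C le_max lexx.
have bC b b' u y : t0 <= u ->
    `|k * fourier_heat (Re \o Pi) u y b + k * fourier_heat (Im \o Pi) u y b'| <= C.
  move=> h; apply: le_trans (_ : k * B (Re \o Pi) + k * B (Im \o Pi) <= _); last first.
    by rewrite /C le_max lexx orbT.
  by apply: le_trans (ler_normD _ _) _; rewrite !normrM (ger0_norm k0) lerD//;
    rewrite ler_wpM2l// bf.
have sol b b' : real_heat `]t0, t1] (fun u y => k * fourier_heat (Re \o Pi) u y b +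
    k * fourier_heat (Im \o Pi) u y b').
  by apply: real_heat_lin; apply: real_heat_fourier; exact: adm.
have jsol b b' : jcont `[t0, t1] (fun u y => k * fourier_heat (Re \o Pi) u y b +
    k * fourier_heat (Im \o Pi) u y b').
  by apply: jcont_lin; exact: jf.
have tt : t0 <= t by case/andP: ht.
apply: complex_ext.
- rewrite Re_heat_integral; [|exact: ip'|exact: iq'].
  apply: (@real_heat_unique t0 t1 C (fun t x => Re (om t x)) (fun u y =>
    k * fourier_heat (Re \o Pi) u y 0 + k * fourier_heat (Im \o Pi) u y (pi / 2))) => //.
  + exact: jc.
  + exact: real_heat_sub hr.
  + by move=> u y hu; apply: le_trans MC; have [] := bM u y hu.
  + by move=> u y /andP[hu _]; exact: bC.
  + by move=> y; rewrite E Re_heat_integral.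
- rewrite Im_heat_integral; [|exact: ip'|exact: iq'].
  apply: (@real_heat_unique t0 t1 C (fun t x => Im (om t x)) (fun u y =>
    k * fourier_heat (Re \o Pi) u y (- (pi / 2)) + k * fourier_heat (Im \o Pi) u y 0)) => //.
  + exact: jc.
  + exact: real_heat_sub hi.
  + by move=> u y hu; apply: le_trans MC; have [] := bM u y hu.
  + by move=> u y /andP[hu _]; exact: bC.
  + by move=> y; rewrite E Im_heat_integral.
Qed.

Lemma normc_sqrtE (z : R[i]) : Normc.normc z = Num.sqrt (Re z ^+ 2 + Im z ^+ 2).
Proof. by case: z. Qed.

Lemma norm_Re_le (z : R[i]) : `|Re z| <= Normc.normc z.
Proof. by rewrite normc_sqrtE -sqrtr_sqr ler_wsqrtr// lerDl sqr_ge0. Qed.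

Lemma norm_Im_le (z : R[i]) : `|Im z| <= Normc.normc z.
Proof. by rewrite normc_sqrtE -sqrtr_sqr ler_wsqrtr// lerDr sqr_ge0. Qed.

Lemma normc_le (z : R[i]) : Normc.normc z <= `|Re z| + `|Im z|.
Proof.
have sqrE (a : R) : a ^+ 2 = `|a| ^+ 2 by rewrite -normrX ger0_norm ?sqr_ge0.
rewrite normc_sqrtE -[leRHS]ger0_norm ?addr_ge0// -sqrtr_sqr ler_wsqrtr//.
rewrite (sqrE (Re z)) (sqrE (Im z)).
have : 0 <= `|Re z| * `|Im z| by rewrite mulr_ge0.
nra.
Qed.

Lemma normc_cexp (z : R[i]) : Normc.normc (cexp z) = expR (Re z).
Proof.
rewrite normc_sqrtE /cexp Re_realM Im_realM/= !exprMn -mulrDr cos2Dsin2 mulr1.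
by rewrite sqrtr_sqr ger0_norm// expR_ge0.
Qed.

Lemma normc_heat_integrand (Pi : R -> R[i]) t x y :
  Normc.normc (heat_integrand Pi t x y) =
  Normc.normc (Pi y) * expR (- (2^-1 * y ^+ 2 * t)).
Proof. by rewrite /heat_integrand Normc.normcM normc_cexp. Qed.

Lemma cintegrable_normc (W : R -> R[i]) : cintegrable W ->
  mu.-integrable setT (EFin \o (fun y => Normc.normc (W y))).
Proof.
move=> [ir ii].
have /integrableP[/measurable_EFinP mr _] := ir.
have /integrableP[/measurable_EFinP mi _] := ii.
have iS := integrable_lin 1 1 measurableT (integrable_norm ir) (integrable_norm ii).
apply: (le_integrable measurableT _ _ iS).
- apply/measurable_EFinP; under eq_fun do rewrite normc_sqrtE.
  apply: (measurableT_comp (f := @Num.sqrt R)).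
    by apply: continuous_measurable_fun; exact: sqrt_continuous.
  by apply: measurable_funD; exact: measurable_funX.
- move=> y _ /=; rewrite lee_fin !mul1r.
  rewrite ger0_norm; last by rewrite normc_sqrtE sqrtr_ge0.
  by rewrite ger0_norm ?addr_ge0//; exact: normc_le.
Qed.

Lemma cintegral_bound (W : R -> R[i]) : cintegrable W ->
  `|Re (cintegral W)| <= \int[mu]_y Normc.normc (W y) /\
  `|Im (cintegral W)| <= \int[mu]_y Normc.normc (W y).
Proof.
move=> iW; have iN := cintegrable_normc iW; have [ir ii] := iW.
split; rewrite /cintegral/=.
- apply: le_trans (le_normr_Rintegral _ ir) _ => //.
  apply: le_Rintegral => //; first exact: (integrable_norm ir).
  by move=> y _; exact: norm_Re_le.
- apply: le_trans (le_normr_Rintegral _ ii) _ => //.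
  apply: le_Rintegral => //; first exact: (integrable_norm ii).
  by move=> y _; exact: norm_Im_le.
Qed.

Lemma cintegrableZ (k : R) (W : R -> R[i]) : cintegrable W ->
  cintegrable (fun y => k%:C * W y).
Proof.
move=> [ir ii]; split; under eq_fun do rewrite ?Re_realM ?Im_realM.
  exact: (integrableZl measurableT k ir).
exact: (integrableZl measurableT k ii).
Qed.

Lemma cintegralZ (k : R) (W : R -> R[i]) : cintegrable W ->
  cintegral (fun y => k%:C * W y) = k%:C * cintegral W.
Proof.
move=> [ir ii]; apply: complex_ext; rewrite ?Re_realM ?Im_realM /cintegral/=.
  by under eq_Rintegral do rewrite Re_realM; rewrite RintegralZl.
by under eq_Rintegral do rewrite Im_realM; rewrite RintegralZl.
Qed.

Lemma ae_mono (P Q : R -> Prop) : (forall y, P y -> Q y) ->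
  {ae mu, forall y, P y} -> {ae mu, forall y, Q y}.
Proof. by move=> PQ; apply: filterS; first exact: (ae_filter_ringOfSetsType mu). Qed.

Lemma cintegrable_ae (V W : R -> R[i]) : cintegrable V ->
  measurable_fun setT (Re \o W) -> measurable_fun setT (Im \o W) ->
  {ae mu, forall y, V y = W y} ->
  cintegrable W /\ cintegral W = cintegral V.
Proof.
have real (f g : R -> R) : mu.-integrable setT (EFin \o f) -> measurable_fun setT g ->
    {ae mu, forall y, f y = g y} ->
    mu.-integrable setT (EFin \o g) /\ \int[mu]_y g y = \int[mu]_y f y.
  move=> /integrableP[mf fi] mg fg.
  have mg' : measurable_fun setT (EFin \o g) by exact/measurable_EFinP.
  have E1 : (\int[mu]_y `|(EFin \o g) y| = \int[mu]_y `|(EFin \o f) y|)%E.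
    apply: ae_eq_integral => //; try exact: measurableT_comp.
    by apply: ae_mono fg => y E _ /=; rewrite E.
  split; first by apply/integrableP; split => //; rewrite E1.
  congr fine; apply: ae_eq_integral => //.
  by apply: ae_mono fg => y E _ /=; rewrite E.
move=> [ir ii] mr mi VW.
have [ir' Er] := real _ _ ir mr (ae_mono (fun y (E : V y = W y) => congr1 Re E) VW).
have [ii' Ei] := real _ _ ii mi (ae_mono (fun y (E : V y = W y) => congr1 Im E) VW).
by split => //; rewrite /cintegral Er Ei.
Qed.

End Uniqueness.

(** * Solutions of the equation *)

Section TimeHorizon.
Context {R : realType}.
Variables (J : set R) (f1 f2 : R -> R) (s : R).
Hypothesis hJ : J = `[0, +oo[%classic \/ J = `]0, +oo[%classic.
Hypothesis hf2 : forall t, J t -> derive_within J f1 t (f2 t).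
Hypothesis hf2c : {within J, continuous f2}.
Hypothesis hs : 0 < s.
Local Notation mu := (@lebesgue_measure R).
Local Notation Re := (@complex.Re R).
Local Notation Im := (@complex.Im R).
Let D := J `&` [set t | t < s].
Let T := [set tau | D (s - tau)].
Let A := drift f1 s.
Let Q t := \int[mu]_(u in `[t, s]) (f1 u) ^+ 2.

Let sK u : s - (s - u) = u. Proof. by rewrite opprB addrC subrK. Qed.

Let DT t : D t -> T (s - t). Proof. by rewrite /T/= sK. Qed.

Let J_up t u : J t -> t <= u -> J u.
Proof.
move=> Jt tu; have [eps [e [_ et sJ _]]] := upper_local_itv hJ Jt.
by apply: sJ; rewrite /= in_itv/= andbT (le_trans et).
Qed.

Let T_gt0 tau : T tau -> 0 < tau.
Proof. by case=> _ /=; rewrite ltrBlDr ltrDl. Qed.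

Let T_itv t1 t2 : T t1 -> T t2 -> `[t1, t2] `<=` T.
Proof.
move=> T1 [J2 _] u /=; rewrite in_itv/= => /andP[h1 h2]; split => /=.
  by apply: J_up J2 _; rewrite lerD2l lerN2.
by have := T_gt0 T1; lra.
Qed.

(** Halving supplies the strictly earlier time that [heat_admissible] demands; it stays in [T]
    because [T] reaches down to 0 without containing it. *)
Let T_half tau : T tau -> T (tau / 2).
Proof.
move=> Tt; have := T_gt0 Tt; case: Tt => Jt _ t0; split => /=; last lra.
by apply: J_up Jt _; lra.
Qed.

Let cf1 : {within J, continuous f1}. Proof. exact: derive_within_continuous hf2. Qed.

Let df1 t : D t -> derive_within D f1 t (f2 t).
Proof.
by move=> [Jt _]; apply: derive_within_sub (hf2 Jt); exists 1 => // u _ [].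
Qed.

Let cf2 : {within D, continuous f2}.
Proof. by apply: continuous_subspaceW hf2c => t []. Qed.

Let dA t : D t -> derive_within D A t (- f1 t).
Proof.
by move=> [Jt ts]; exact: (derive_within_tail_integral (upper_local_itv hJ) cf1 Jt ts).
Qed.

Let dQ t : D t -> derive_within D Q t (- (f1 t) ^+ 2).
Proof.
move=> [Jt ts].
apply: (derive_within_tail_integral (g := fun u => f1 u ^+ 2) (upper_local_itv hJ) _ Jt ts).
apply: within_continuousP => u Ju.
by apply: cvgM; exact: derive_within_cvg (hf2 Ju).
Qed.

Let Q_ge0 t : 0 <= Q t.
Proof. by apply: Rintegral_ge0 => u _; rewrite sqr_ge0. Qed.

Lemma pde_solution_iff (w : R -> R -> R[i]) :
  pde_solution D f2 w <->
  exists om : R -> R -> R[i], heat_solution T om /\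
    forall t a, D t -> w t a = (prefactor f1 s t a)%:C * om (s - t) (a + A t).
Proof.
split.
  move=> /pde_solutionP[wr wi].
  pose om tau x : R[i] := (expR (- (2^-1 * Q (s - tau)) + A (s - tau) * f1 (s - tau) +
    x * (- f1 (s - tau))))%:C * w (s - tau) (x + - A (s - tau)).
  exists om; split.
    apply/heat_solutionP; split.
      apply: (real_heat_ext _ (real_heat_of_pde s df1 dA dQ cf2 wr)) => t a _.
      by rewrite /om Re_realM.
    apply: (real_heat_ext _ (real_heat_of_pde s df1 dA dQ cf2 wi)) => t a _.
    by rewrite /om Im_realM.
  move=> t a Dt; rewrite /om sK addrK mulrA -rmorphM /prefactor -expRD.
  rewrite (_ : _ + _ = 0) ?expR0 ?mul1r//.
  rewrite /Q; ring.
move=> [om [/heat_solutionP[hr hi] wE]]; apply/pde_solutionP; split.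
  apply: (real_pde_ext _ (real_pde_of_heat df1 dA dQ cf2 hr)) => t a Dt.
  by rewrite wE// Re_realM.
apply: (real_pde_ext _ (real_pde_of_heat df1 dA dQ cf2 hi)) => t a Dt.
by rewrite wE// Im_realM.
Qed.

Lemma admissible_heat_solution (Pi : R -> R[i]) : admissible D f1 s Pi ->
  heat_solution T (heat_integral Pi).
Proof.
move=> adm.
have G tau : T tau -> gauss_integrable (Re \o Pi) tau /\ gauss_integrable (Im \o Pi) tau.
  by move=> Tt; have /cintegrable_heatP := adm (s - tau) 0 Tt; rewrite sK.
by apply: heat_integral_solution => tau Tt; exists (tau / 2);
  do 1?[by have := T_gt0 Tt; lra]; have [] := G _ (T_half Tt).
Qed.

Lemma heat_integrand_phase (W : R -> R[i]) x :
  heat_integrand W 0 x = fun y => W y * cexp (0 +i* (y * x)).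
Proof. by apply/funext => y; rewrite /heat_integrand mulr0 oppr0. Qed.

Lemma w_formula_fourier (Pi : R -> R[i]) (w : R -> R -> R[i]) :
  admissible D f1 s Pi -> (forall t a, D t -> w t a = w_formula f1 s Pi t a) ->
  fourier_representable D f1 w.
Proof.
move=> adm wE.
exists (fun t y => (expR (2^-1 * Q t))%:C * heat_integrand Pi (s - t) (A t) y); split.
- by move=> t Dt; apply: cintegrableZ; have := adm t 0 Dt; rewrite add0r.
- move=> K cK KD; have [->|/set0P K0] := eqVneq K set0; first by exists 0.
  (* The Gaussian factor is largest at the latest time [tM] of [K], where [s - t] is smallest, and
     [exp (Q t / 2)] is largest at a possibly different time [tQ]; the product of the two maxima
     bounds the norms. *)
  have [tM /set_mem KtM HM] : exists2 c, c \in K & forall t, t \in K -> t <= c.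
    apply: (@compact_EVT_max _ _ id) => //.
    by apply: continuous_subspaceT => x; exact: cvg_id.
  have [tQ _ HQ] : exists2 c, c \in K & forall t, t \in K -> Q t <= Q c.
    apply: (@compact_EVT_max _ _ Q) => //.
    by apply: continuous_subspaceW KD _; exact: derive_within_continuous dQ.
  have iM : cintegrable (heat_integrand Pi (s - tM) (A tM)).
    by have := adm tM 0 (KD _ KtM); rewrite add0r.
  have iN := cintegrable_normc iM.
  exists (\int[mu]_y (expR (2^-1 * Q tQ) * Normc.normc (heat_integrand Pi (s - tM) (A tM) y))).
  move=> t Kt; apply: le_Rintegral => //.
  + apply: cintegrable_normc; apply: cintegrableZ.
    by have := adm t 0 (KD _ Kt); rewrite add0r.
  + exact: (integrableZl measurableT _ iN).
  move=> y _; rewrite Normc.normcM !normc_heat_integrand.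
  have -> : Normc.normc (expR (2^-1 * Q t))%:C = expR (2^-1 * Q t).
    by rewrite normc_sqrtE/= expr0n/= addr0 sqrtr_sqr ger0_norm// expR_ge0.
  have n0 : 0 <= Normc.normc (Pi y) by rewrite normc_sqrtE sqrtr_ge0.
  apply: ler_pM; [exact: expR_ge0|by rewrite mulr_ge0 ?expR_ge0| |].
    by rewrite ler_expR ler_wpM2l// HQ//; exact/mem_set.
  apply: ler_wpM2l => //; apply: gauss_le.
  by rewrite lerD2l lerN2 HM//; exact/mem_set.
- move=> t a Dt; rewrite wE// -heat_integrand_phase heat_integrandZ heat_integrandD.
  have iP : cintegrable (heat_integrand Pi (s - t + 0) (A t + a)).
    by rewrite addr0 (addrC (A t)); exact: adm.
  rewrite cintegralZ// /w_formula /heat_integral addr0 (addrC (A t)) /prefactor.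
  by rewrite -/(Q t) expRD rmorphM; ring.
Qed.

Lemma heat_integral_shift (Pi : R -> R[i]) t t' x x' :
  heat_integral (heat_integrand Pi t x) t' x' = heat_integral Pi (t + t') (x + x').
Proof. by rewrite /heat_integral heat_integrandD. Qed.

Lemma cintegrable_shift (W : R -> R[i]) t x : 0 <= t -> cintegrable W ->
  cintegrable (heat_integrand W t x).
Proof.
move=> t0; rewrite -{1}(heat_integrand00 W) => /cintegrable_heatP[i1 i2].
by apply/cintegrable_heatP; split; apply: gauss_integrable_le t0 _.
Qed.

Lemma fourier_solution_formula (w : R -> R -> R[i]) :
  pde_solution D f2 w -> fourier_representable D f1 w ->
  exists Pi : R -> R[i], admissible D f1 s Pi /\
    forall t a, D t -> w t a = w_formula f1 s Pi t a.
Proof.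
move=> /pde_solution_iff[om [som omE]] [W [iW bW wE]].
(* The amplitude of [om tau]; it must be a Gaussian multiple of [V (s / 2)]. *)
pose V tau : R -> R[i] := fun y =>
  (expR (- (2^-1 * Q (s - tau))))%:C * heat_integrand (W (s - tau)) 0 (- A (s - tau)) y.
have iV tau : T tau -> cintegrable (V tau).
  by move=> Tt; apply: cintegrableZ; apply: cintegrable_shift => //; exact: iW.
have omV tau x : T tau -> om tau x = heat_integral (V tau) 0 x.
  move=> Tt; set t := s - tau; set a := x - A t.
  have Px : (prefactor f1 s t a)%:C != 0.
    by rewrite eq_complex/= gt_eqF// expR_gt0.
  apply: (mulfI Px).
  have := omE t a Tt; rewrite [s - t]sK [a + A t]subrK => <-.
  rewrite wE// /heat_integral /V heat_integrandZ heat_integrandD addr0 (addrC _ x).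
  rewrite -heat_integrand_phase cintegralZ; last by apply: cintegrable_shift => //; exact: iW.
  have -> : expR (a * f1 t) = prefactor f1 s t a * expR (- (2^-1 * Q t)).
    by rewrite /prefactor -expRD; congr expR; rewrite /Q; ring.
  by rewrite rmorphM; ring.
(* The strip of times [[t1, t2]] corresponds to the compact set [[s - t2, s - t1]] in [D]; since [Q]
   is nonnegative, the factor [exp (- Q / 2)] is at most 1 and the bound for [W] passes to [V]. *)
have omB t1 t2 : T t1 -> T t2 -> exists M : R, forall t x, t1 <= t <= t2 ->
    `|Re (om t x)| <= M /\ `|Im (om t x)| <= M.
  move=> T1 T2; have sT := T_itv T1 T2.
  have [||M HM] := bW `[s - t2, s - t1]%classic.
  - exact: segment_compact.
  - move=> u /=; rewrite in_itv/= => hu; rewrite -(sK u).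
    by apply: sT; rewrite /= in_itv/=; lra.
  exists ((2 * pi)^-1 * M) => t x ht.
  have Tt : T t by apply: sT; rewrite /= in_itv.
  have k0 : 0 <= (2 * pi : R)^-1 by rewrite invr_ge0 mulr_ge0// pi_ge0.
  have iVx : cintegrable (heat_integrand (V t) 0 x).
    by apply: cintegrable_shift => //; exact: iV.
  have le : \int[mu]_y Normc.normc (heat_integrand (V t) 0 x y) <= M.
    apply: le_trans (HM (s - t) _); last by rewrite /= in_itv/=; lra.
    apply: le_Rintegral => //; first exact: cintegrable_normc.
      by apply: cintegrable_normc; exact: iW.
    move=> y _; rewrite normc_heat_integrand mulr0 oppr0 expR0 mulr1 Normc.normcM.
    rewrite normc_heat_integrand mulr0 oppr0 expR0 mulr1.
    rewrite ler_piMl; first by []; first by rewrite normc_sqrtE sqrtr_ge0.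
    rewrite normc_sqrtE/= expr0n/= addr0 sqrtr_sqr ger0_norm ?expR_ge0//.
    by rewrite -expR0 ler_expR oppr_le0 mulr_ge0 ?Q_ge0.
  have [b1 b2] := cintegral_bound iVx.
  rewrite omV// /heat_integral Re_realM Im_realM !normrM (ger0_norm k0).
  by split; rewrite ler_wpM2l//; exact: le_trans le.
(* Evolving [V t1] back to time 0 is a pointwise operation; [P] need not be integrable, and only its
   Gaussian multiples are integrated. *)
have back t1 : exists P : R -> R[i], forall t x,
    heat_integrand P t x = heat_integrand (V t1) (t - t1) x.
  exists (heat_integrand (V t1) (- t1) 0) => t x.
  by rewrite heat_integrandD add0r addrC.
(* Both sides have the Fourier integral [om t2]: the left by definition of [V], the right because
   the bounded solution starting from [om t1] is unique. Injectivity then identifies the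
   amplitudes. *)
have key t1 t2 : T t1 -> T t2 -> t1 <= t2 ->
    {ae mu, forall y, V t2 y = heat_integrand (V t1) (t2 - t1) 0 y}.
  move=> T1 T2 t12; have [P PE] := back t1.
  have iP : cintegrable (heat_integrand P t1 0) by rewrite PE subrr heat_integrand00; exact: iV.
  have /cintegrable_heatP[g1 g2] := iP.
  have [M HM] := omB _ _ T1 T2.
  apply: heat_integral_inj; first exact: iV.
    by apply: cintegrable_shift; [rewrite subr_ge0|exact: iV].
  move=> x; rewrite -omV// heat_integral_shift addr0 add0r.
  have E1 z : om t1 z = heat_integral P t1 z.
    by rewrite (omV _ _ T1) /heat_integral PE subrr.
  have ht2 : t1 <= t2 <= t2 by rewrite t12 lexx.
  by rewrite (heat_integral_unique (T_itv T1 T2) som HM g1 g2 E1 x ht2) /heat_integral PE.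
(* Any reference time in [T] would do; [s / 2] lies in [T] whether or not [J] contains 0. *)
have T0 : T (s / 2).
  have h := hs; split => /=; last by lra.
  by case: hJ => ->; rewrite /= in_itv/= andbT; lra.
set t0 := s / 2 in T0.
have [P PE] := back t0.
have VP t : T t -> {ae mu, forall y, V t y = heat_integrand P t 0 y}.
  move=> Tt; have [h|/ltW h] := leP t0 t.
    by have := key _ _ T0 Tt h; rewrite PE.
  (* For [t] before [t0] the relation leads from [t] to [t0], and it is inverted pointwise by a
     Gaussian factor of negative time. *)
  apply: ae_mono (key _ _ Tt T0 h) => y E.
  rewrite PE /(heat_integrand (V t0)) E.
  rewrite -/(heat_integrand (heat_integrand (V t) (t0 - t) 0) (t - t0) 0 y).
  by rewrite heat_integrandD addr0 addrC -opprB addNr heat_integrand00.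
have [g1 g2] : gauss_integrable (Re \o P) t0 /\ gauss_integrable (Im \o P) t0.
  by apply/(cintegrable_heatP P t0 0); rewrite PE subrr heat_integrand00; exact: iV.
have m1 := gauss_integrable_measurable g1; have m2 := gauss_integrable_measurable g2.
(* The null set excluded in [VP] may depend on [t]; this is harmless, as each integral concerns a
   single time. *)
have fin t x : T t -> cintegrable (heat_integrand P t x) /\
    cintegral (heat_integrand P t x) = cintegral (heat_integrand (V t) 0 x).
  move=> Tt; apply: cintegrable_ae.
  - by apply: cintegrable_shift => //; exact: iV.
  - rewrite (_ : _ \o _ = fun y => Re (P y) * heat_kernel t x 0 y +
      Im (P y) * heat_kernel t x (pi / 2) y); last first.
      by apply/funext => y /=; exact: Re_heat_integrand.
    by apply: measurable_funD; apply: measurable_funM => //; exact: measurable_heat_kernel.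
  - rewrite (_ : _ \o _ = fun y => Re (P y) * heat_kernel t x (- (pi / 2)) y +
      Im (P y) * heat_kernel t x 0 y); last first.
      by apply/funext => y /=; exact: Im_heat_integrand.
    by apply: measurable_funD; apply: measurable_funM => //; exact: measurable_heat_kernel.
  - apply: ae_mono (VP t Tt) => y E.
    by rewrite {1}/heat_integrand E -/(heat_integrand (heat_integrand P t 0) 0 x y)
      heat_integrandD addr0 add0r.
exists P; split.
  by move=> t a Dt; have [] := fin (s - t) (a + drift f1 s t) (DT Dt).
move=> t a Dt; rewrite omE// /w_formula; congr (_ * _).
rewrite omV; last exact: DT.
by rewrite /heat_integral; have [_ ->] := fin (s - t) (a + drift f1 s t) (DT Dt).
Qed.

End TimeHorizon.

Theorem theorem2p2 (R : realType) (J : set R) (f f1 f2 : R -> R) (s : R)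
  (* J = [0, +oo[ when f is C^2 up to time 0 (one-sided derivatives at 0),
     J = ]0, +oo[ when f is only C^2 at positive times *)
  (hJ : J = `[0, +oo[%classic \/ J = `]0, +oo[%classic)
  (hf1 : forall t, J t -> derive_within J f t (f1 t))
  (hf2 : forall t, J t -> derive_within J f1 t (f2 t))
  (hf2c : {within J, continuous f2})
  (hFTC : forall t, 0 < t ->
     f t = f 0 + \int[@lebesgue_measure R]_(u in `[0, t]) f1 u)
  (hconvex : forall t, 0 < t -> 0 < f2 t)
  (hL2 : forall t, 0 < t ->
     (\int[@lebesgue_measure R]_(u in `[0%R, t]) ((f1 u) ^+ 2)%:E < +oo)%E)
  (hs : 0 < s) :
  let D := J `&` [set t | t < s] in
  let T := [set tau | D (s - tau)] in
  (* the two lines of the formula agree, for some heat solution *)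
  (forall Pi : R -> R[i], admissible D f1 s Pi ->
     exists om : R -> R -> R[i], heat_solution T om /\
       forall t a, D t ->
         w_formula f1 s Pi t a =
         (prefactor f1 s t a)%:C * om (s - t) (a + drift f1 s t)) /\
  (* the solutions are given by the second line *)
  (forall w : R -> R -> R[i],
     pde_solution D f2 w <->
     exists om : R -> R -> R[i], heat_solution T om /\
       forall t a, D t ->
         w t a = (prefactor f1 s t a)%:C * om (s - t) (a + drift f1 s t)) /\
  (* the solutions that are Fourier integrals in a are given by the first line *)
  (forall w : R -> R -> R[i],
     (pde_solution D f2 w /\ fourier_representable D f1 w) <->
     exists Pi : R -> R[i], admissible D f1 s Pi /\
       forall t a, D t -> w t a = w_formula f1 s Pi t a).
Proof.
move=> D T; split; [|split].
- move=> Pi adm; exists (heat_integral Pi); split => //.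
  exact: (admissible_heat_solution hJ adm).
- exact: (pde_solution_iff s hJ hf2 hf2c).
- move=> w; split.
    by move=> [pde rep]; exact: (fourier_solution_formula hJ hf2 hf2c hs pde rep).
  move=> [Pi [adm wE]]; split.
    apply/(pde_solution_iff s hJ hf2 hf2c); exists (heat_integral Pi); split => //.
    exact: (admissible_heat_solution hJ adm).
  exact: (w_formula_fourier hJ hf2 adm wE).
Qed.
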